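(* Let $\Bbbk$ be an algebraically closed field of characteristic $p>0$, and let $H=\Bbbk[C_p^n]^*$ for some positive integer $n$. Then any $H$-cleft extension of a finite-dimensional commutative local algebra $A$ over $\Bbbk$ is twist equivalent to some smash product $A\#H$. Moreover, there are exactly 3 twist inequivalent smash products $A\#H$, $A\#'H$ and $A\#''H$, and their $H$-actions on $A$ are respectively given by $$x\cdot t=0,\qquad x\cdot t=t,\qquad x\cdot t=t+1,$$ where $x$ is a primitive generator of $H$ satisfying $x^{p^n}=x$, and $t$ is a nilpotent generator of $A$. The last action $x\cdot t=t+1$ only occurs when $p\mid\dim A$.
   Context: $C_p$ is the cyclic group of order $p$, and $\Bbbk[C_p^n]^*$ is the dual Hopf algebra of the group algebra of $C_p^n$. As a Hopf algebra, $\Bbbk[C_p^n]^*\cong\Bbbk[x]/(x^{p^n}-x)$ with $x$ primitive ($\Delta(x)=x\otimes1+1\otimes x$), so an $H$-module algebra structure on $A$ is determined by the action of $x$, which is a $\Bbbk$-derivation of $A$. For an $H$-module algebra $A$, the smash product $A\#H$ is $A\otimes H$ with multiplication $(a\#h)(b\#k)=\sum a(h_1\cdot b)\#h_2k$; $A$ is identified with $A\#1$, and $A\#H$ is a right $H$-comodule via $\mathrm{id}\otimes\Delta$. The notations $A\#H$, $A\#'H$, $A\#''H$ denote smash products for different $H$-actions on $A$. Let $B$ be a right $H$-comodule algebra with coaction $\rho_B:B\to B\otimes H$ and let $A\subseteq B$ be a subalgebra. $A\subseteq B$ is an $H$-cleft extension if the coinvariants satisfy $B^{co H}=A$ and there is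 a convolution-invertible right $H$-comodule map $H\to B$. Two $H$-cleft extensions $B,B'$ of $A$ are twist equivalent if there exist an algebra automorphism $\varphi$ of $A$, a Hopf algebra automorphism $\phi$ of $H$ and an algebra isomorphism $f:B\to B'$ such that $f(ab)=\varphi(a)f(b)$ for all $a\in A$, $b\in B$, and $(f\otimes\mathrm{id})\circ\rho_B=(\mathrm{id}\otimes\phi)\circ\rho_{B'}\circ f$.
   Formalization: The classification of actions is stated for those A that have a nilpotent generator t (not every commutative local A does); if p does not divide dim A there are two actions, x·t=0 and x·t=t, claimed inequivalent only for t≠0, since they coincide for A=k. *)

(* Defs.v *)
From HB Require Import structures.
From mathcomp Require Import all_boot all_order all_algebra all_fingroup all_field.
Set Implicit Arguments.
Unset Strict Implicit.
Unset Printing Implicit Defensive.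
Import GRing.Theory.
Local Open Scope ring_scope.

(* For a finite group G put H := k[G]^*, the dual Hopf algebra of the group *)
(* algebra k[G].  For every k-module M the tensor product M (x) H is *)
(* canonically Hom_k(k[G], M), i.e. the space of functions G -> M, the pure *)
(* tensor m (x) h being the function g |-> h g *: m (see [tens], and [tfold_tens]*)
(* for the universal property).  The algebra structure of B (x) H, for B an *)
(* algebra, is then the pointwise one (see [tensM]).  H itself is k (x) H. *)
Definition tensor (G : finGroupType) (M : Type) : Type := {ffun G -> M}.

HB.instance Definition _ (k : comNzRingType) (G : finGroupType)
  (M : lmodType k) := GRing.Lmodule.copy (tensor G M) {ffun G -> M}.

Section TensorAlgebra.
Variables (k : comNzRingType) (G : finGroupType) (B : algType k).
Implicit Types u v w : tensor G B.

Definition tensor_one : tensor G B := [ffun=> 1].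
Definition tensor_mul u v : tensor G B := [ffun g => u g * v g].

Fact tensor_mulA : associative tensor_mul.
Proof. by move=> u v w; apply/ffunP=> g; rewrite !ffunE mulrA. Qed.
Fact tensor_mul1l : left_id tensor_one tensor_mul.
Proof. by move=> u; apply/ffunP=> g; rewrite !ffunE mul1r. Qed.
Fact tensor_mul1r : right_id tensor_one tensor_mul.
Proof. by move=> u; apply/ffunP=> g; rewrite !ffunE mulr1. Qed.
Fact tensor_mulDl : left_distributive tensor_mul +%R.
Proof. by move=> u v w; apply/ffunP=> g; rewrite !ffunE mulrDl. Qed.
Fact tensor_mulDr : right_distributive tensor_mul +%R.
Proof. by move=> u v w; apply/ffunP=> g; rewrite !ffunE mulrDr. Qed.
Fact tensor_one_neq0 : tensor_one != 0.
Proof. by apply/eqP=> /ffunP/(_ 1%g)/eqP; rewrite !ffunE oner_eq0. Qed.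

HB.instance Definition _ := GRing.Zmodule_isNzRing.Build (tensor G B)
  tensor_mulA tensor_mul1l tensor_mul1r tensor_mulDl tensor_mulDr
  tensor_one_neq0.

Fact tensor_scaleAl (a : k) u v : a *: (u * v) = a *: u * v.
Proof. by apply/ffunP=> g; rewrite !ffunE scalerAl. Qed.
HB.instance Definition _ := GRing.Lmodule_isLalgebra.Build k (tensor G B)
  tensor_scaleAl.

Fact tensor_scaleAr (a : k) u v : a *: (u * v) = u * (a *: v).
Proof. by apply/ffunP=> g; rewrite !ffunE scalerAr. Qed.
HB.instance Definition _ := GRing.Lalgebra_isAlgebra.Build k (tensor G B)
  tensor_scaleAr.
End TensorAlgebra.

Section DualHopfAlgebra.
Variables (k : comNzRingType) (G : finGroupType).

Definition dualgrp : algType k := tensor G k^o.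
Local Notation H := dualgrp.

(* The basis of H dual to the basis G of k[G]. *)
Definition delta (g : G) : H := [ffun g' => (g == g')%:R].

Definition tens (M : lmodType k) (m : M) (h : H) : tensor G M :=
  [ffun g => (h g : k) *: m].

(* The linear map induced on M (x) H by a bilinear F : M x H -> N; it gives *)
(* Sweedler sums: tfold F (Delta h) = \sum F h_1 h_2. *)
Definition tfold (M N : lmodType k) (F : M -> H -> N) (T : tensor G M) : N :=
  \sum_g F (T g) (delta g).

(* Transposed multiplication of k[G]: <Delta h, g (x) g'> = <h, g g'>, with *)
(* H (x) H = tensor G H whose second factor is the outer index. *)
Definition comul (h : H) : tensor G H := [ffun g' => [ffun g => h (g * g')%g]].
Definition counit (h : H) : k := h 1%g.
Definition antipode (h : H) : H := [ffun g => h g^-1%g].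

Lemma tens_delta (M : lmodType k) (T : tensor G M) :
  T = \sum_g tens (T g) (delta g).
Proof.
apply/ffunP=> s; rewrite sum_ffunE (bigD1 s) //= !ffunE eqxx scale1r.
rewrite big1 ?addr0 // => g /negPf gs.
by rewrite !ffunE gs scale0r.
Qed.

Lemma dual_delta (h : H) : h = \sum_g (h g : k) *: delta g.
Proof.
apply/ffunP=> s; rewrite sum_ffunE (bigD1 s) //= !ffunE eqxx.
rewrite big1 ?addr0 => [|g /negPf gs]; first by rewrite /GRing.scale /= mulr1.
by rewrite !ffunE gs /GRing.scale /= mulr0.
Qed.

Lemma tfold_tens (M N : lmodType k) (F : M -> H -> N) (m : M) (h : H) :
    (forall h', linear (F^~ h')) -> (forall m', linear (F m')) ->
  tfold F (tens m h) = F m h.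
Proof.
move=> linl linr; rewrite {2}(dual_delta h) /tfold.
pose Fm : {linear H -> N} := HB.pack (F m) (GRing.isLinear.Build _ _ _ _ _ (linr m)).
rewrite (_ : F m _ = Fm (\sum_g (h g : k) *: delta g)) // linear_sum.
apply: eq_bigr => g _; rewrite linearZ /= ffunE.
pose Fl : {linear M -> N} :=
  HB.pack (F^~ (delta g)) (GRing.isLinear.Build _ _ _ _ _ (linl (delta g))).
by rewrite (_ : F _ _ = Fl ((h g : k) *: m)) // linearZ.
Qed.

Lemma tensM (B : algType k) (b b' : B) (h h' : H) :
  tens b h * tens b' h' = tens (b * b') (h * h').
Proof. by apply/ffunP=> g; rewrite !ffunE -scalerAl -scalerAr scalerA. Qed.

(* f (x) id and id (x) psi. *)
Definition tensl (M N : lmodType k) (f : M -> N) : tensor G M -> tensor G N :=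
  tfold (fun m h => tens (f m) h).
Definition tensr (M : lmodType k) (psi : H -> H) : tensor G M -> tensor G M :=
  tfold (fun m h => tens m (psi h)).

(* id (x) Delta, with values in M (x) (H (x) H) = (M (x) H) (x) H. *)
Definition tens_comul (M : lmodType k) : tensor G M -> tensor G (tensor G M) :=
  tfold (fun m h => tfold (fun h1 h2 => tens (tens m h1) h2) (comul h)).

Lemma tenslE (M N : lmodType k) (f : M -> N) (T : tensor G M) :
  tensl f T = [ffun g => f (T g)].
Proof.
rewrite [RHS]tens_delta; apply: eq_bigr => g _.
by rewrite ffunE.
Qed.

Lemma counit_delta (g : G) : counit (delta g) = (g == 1%g)%:R.
Proof. by rewrite /counit [LHS]ffunE eq_sym. Qed.

Lemma comul_delta (g g' : G) : comul (delta g) g' = delta (g * g'^-1)%g.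
Proof.
apply/ffunP=> s; rewrite !ffunE; congr (nat_of_bool _)%:R.
by apply/eqP/eqP => [->|<-]; rewrite ?mulgK ?mulgKV.
Qed.

Lemma tens_comulE (M : lmodType k) (T : tensor G M) :
  tens_comul T = [ffun g' => [ffun g => T (g * g')%g]].
Proof.
apply/ffunP=> g'; apply/ffunP=> g; rewrite /tens_comul /tfold sum_ffunE sum_ffunE.
rewrite (bigD1 (g * g')%g) //= [X in _ + X]big1 => [|r /negPf rn].
  rewrite sum_ffunE sum_ffunE (bigD1 g') //= big1 => [|s /negPf sn].
    by rewrite !ffunE !eqxx !scale1r !addr0.
  by rewrite !ffunE sn scale0r.
rewrite sum_ffunE sum_ffunE big1 // => s _; rewrite !ffunE.
case: eqP => [->|]; last by rewrite scale0r.
by rewrite rn scale0r scaler0.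
Qed.

Record hopf_automorphism (phi : {lrmorphism H -> H}) : Prop := HopfAut {
  hopf_aut_bij : bijective phi;
  hopf_aut_comul : forall h, comul (phi h) = tensl phi (tensr phi (comul h));
  hopf_aut_counit : forall h, counit (phi h) = counit h }.

Definition primitive (x : H) : Prop := comul x = tens x 1 + tens 1 x.

(* Right H-comodule algebras: rho is an algebra map B -> B (x) H. *)
Record comodule_algebra (B : algType k) (rho : B -> tensor G B) : Prop :=
  ComoduleAlgebra {
  coact_linear : linear rho;
  coact_one : rho 1 = 1;
  coact_mul : {morph rho : b c / b * c};
  coact_coassoc : forall b, tensl rho (rho b) = tens_comul (rho b);
  coact_counit : forall b, tfold (fun c h => counit h *: c) (rho b) = b }.

Definition convolution (B : algType k) (f f' : H -> B) (h : H) : B :=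
  tfold (fun h1 h2 => f h1 * f' h2) (comul h).

Definition convolution_invertible (B : algType k) (f : H -> B) : Prop :=
  exists f' : H -> B, [/\ linear f',
    forall h, convolution f f' h = (counit h)%:A
  & forall h, convolution f' f h = (counit h)%:A].

Definition comodule_map (B : algType k) (rho : B -> tensor G B) (f : H -> B) :
  Prop := linear f /\ forall h, rho (f h) = tensl f (comul h).

(* The inclusion of the subalgebra A in B is recorded as an embedding of *)
(* k-algebras. *)
Record cleft_extension (A : algType k) := CleftExtension {
  cleft_alg :> algType k;
  cleft_incl : {lrmorphism A -> cleft_alg};
  cleft_coact : cleft_alg -> tensor G cleft_alg;
  cleft_incl_inj : injective cleft_incl;
  cleft_comodule : comodule_algebra cleft_coact;
  cleft_coinv : forall b, cleft_coact b = tens b 1 <-> exists a, b = cleft_incl a;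
  cleft_cleaving : exists gamma : H -> cleft_alg,
    comodule_map cleft_coact gamma /\ convolution_invertible gamma }.

Definition twist_equivalent (A : algType k) (E E' : cleft_extension A) : Prop :=
  exists (phiA : {lrmorphism A -> A}) (phiH : {lrmorphism H -> H})
         (f : {lrmorphism E -> E'}),
  [/\ bijective phiA, hopf_automorphism phiH, bijective f,
      forall (a : A) (b : E),
        f (cleft_incl E a * b) = cleft_incl E' (phiA a) * f b
    & forall b : E, tensl f (cleft_coact b) = tensr phiH (cleft_coact (f b))].

Record module_algebra (A : algType k) := ModuleAlgebra {
  act :> H -> A -> A;
  act_linearl : forall a, linear (act^~ a);
  act_linearr : forall h, linear (act h);
  act_1 : forall a, act 1 a = a;
  act_M : forall h l a, act (h * l) a = act h (act l a);
  act_mul : forall h a b,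
    act h (a * b) = tfold (fun h1 h2 => act h1 a * act h2 b) (comul h);
  act_one : forall h, act h 1 = (counit h)%:A }.

(* The underlying module of A # H is A (x) H. *)
Definition smash_module (A : algType k) (alpha : module_algebra A) : Type :=
  tensor G A.

Section Smash.
Variables (A : algType k) (alpha : module_algebra A).

Local Notation smash := (smash_module alpha).
HB.instance Definition _ := GRing.Lmodule.copy smash (tensor G A).
Implicit Types u v w : smash.

Definition smash_one : smash := tens 1 1.
(* (a # h) (b # l) = \sum a (h_1 . b) # h_2 l, extended bilinearly. *)
Definition smash_mul u v : smash :=
  tfold (fun a h => tfold (fun b l =>
    tfold (fun h1 h2 => tens (a * alpha h1 b) (h2 * l)) (comul h)) v) u.

Let act0l a : alpha 0 a = 0.
Proof.
have := act_linearl alpha a 1 0 0.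
by rewrite !scale1r add0r => /(congr1 (fun z => z - alpha 0 a)); rewrite subrr addrK.
Qed.
HB.instance Definition _ h :=
  GRing.isLinear.Build k A A *:%R (alpha h) (act_linearr alpha h).
Let al a (h : H) := alpha h a.
HB.instance Definition _ a :=
  GRing.isLinear.Build k H A *:%R (al a) (act_linearl alpha a).

Lemma deltaM (g g' : G) : delta g * delta g' = if g == g' then delta g else 0.
Proof.
apply/ffunP=> s; rewrite ffunE; case: eqP => [->|gg']; rewrite !ffunE.
  by case: eqP; rewrite ?mulr1 ?mulr0.
case: eqP => [gs|_]; last by rewrite mul0r.
by case: eqP => [g's|_]; [case: gg'; rewrite gs | rewrite mulr0].
Qed.

Lemma smash_mulE u v :
  smash_mul u v = [ffun s => \sum_g u g * alpha (delta (g * s^-1)%g) (v s)].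
Proof.
apply/ffunP=> s; rewrite ffunE sum_ffunE; apply: eq_bigr => g _.
rewrite sum_ffunE (bigD1 s) //= [X in _ + X]big1 => [|r /negPf rn].
  rewrite addr0 sum_ffunE (bigD1 s) //= big1 => [|r /negPf rn].
    by rewrite addr0 comul_delta !ffunE !eqxx mulr1 scale1r.
  by rewrite !ffunE rn mul0r scale0r.
by rewrite sum_ffunE big1 // => q _; rewrite !ffunE rn mulr0 scale0r.
Qed.

Lemma act_delta_mul g a b : alpha (delta g) (a * b) =
  \sum_r alpha (delta (g * r^-1)%g) a * alpha (delta r) b.
Proof. by rewrite act_mul; apply: eq_bigr => r _; rewrite comul_delta. Qed.

Lemma act_delta_one g : alpha (delta g) 1 = (g == 1%g)%:R.
Proof.
rewrite act_one counit_delta.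
by case: eqP; rewrite ?scale1r ?scale0r.
Qed.

Fact smash_mulA : associative smash_mul.
Proof.
move=> u v w; rewrite !smash_mulE; apply/ffunP=> s; rewrite !ffunE.
under eq_bigr => r _ do rewrite linear_sum mulr_sumr.
under [RHS]eq_bigr => g _ do rewrite ffunE mulr_suml.
rewrite exchange_big /=; apply: eq_bigr => g _; apply: eq_bigr => r _.
rewrite act_delta_mul (bigD1 (g * s^-1)%g) //= big1 => [|q qn].
  by rewrite addr0 -act_M deltaM eqxx invMg invgK mulgA mulgKV mulrA.
by rewrite -act_M deltaM (negPf qn) act0l mulr0.
Qed.

Fact smash_mul1l : left_id smash_one smash_mul.
Proof.
move=> u; rewrite smash_mulE; apply/ffunP=> s; rewrite ffunE.
under eq_bigr => g _ do rewrite !ffunE scale1r mul1r -/(al _ _).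
rewrite -linear_sum /al -[RHS](act_1 alpha); congr (alpha _ _).
apply/ffunP=> q; rewrite sum_ffunE (bigD1 (q * s)%g) //= big1 => [|g gn].
  by rewrite !ffunE mulgK eqxx addr0.
rewrite ffunE; case: eqP => // gq; case/eqP: gn.
by rewrite -gq mulgKV.
Qed.

Fact smash_mul1r : right_id smash_one smash_mul.
Proof.
move=> u; rewrite smash_mulE; apply/ffunP=> s; rewrite !ffunE scale1r.
rewrite (bigD1 s) //= big1 => [|g gn].
  by rewrite act_delta_one mulgV eqxx mulr1 addr0.
by rewrite act_delta_one -eq_mulgV1 (negPf gn) mulr0.
Qed.

Fact smash_mulDl : left_distributive smash_mul +%R.
Proof.
move=> u v w; rewrite !smash_mulE; apply/ffunP=> s; rewrite !ffunE -big_split.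
by apply: eq_bigr => g _; rewrite ffunE mulrDl.
Qed.

Fact smash_mulDr : right_distributive smash_mul +%R.
Proof.
move=> u v w; rewrite !smash_mulE; apply/ffunP=> s; rewrite !ffunE -big_split.
by apply: eq_bigr => g _; rewrite linearD mulrDr.
Qed.

Fact smash_one_neq0 : smash_one != 0.
Proof. by apply/eqP=> /ffunP/(_ 1%g)/eqP; rewrite !ffunE scale1r oner_eq0. Qed.

HB.instance Definition _ := GRing.Zmodule_isNzRing.Build smash
  smash_mulA smash_mul1l smash_mul1r smash_mulDl smash_mulDr smash_one_neq0.

Fact smash_scaleAl (a : k) u v : a *: (u * v) = (a *: u : smash) * v.
Proof.
rewrite /GRing.mul /= !smash_mulE; apply/ffunP=> s; rewrite !ffunE scaler_sumr.
by apply: eq_bigr => g _; rewrite ffunE scalerAl.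
Qed.
HB.instance Definition _ := GRing.Lmodule_isLalgebra.Build k smash smash_scaleAl.

Fact smash_scaleAr (a : k) u v : a *: (u * v) = u * (a *: v : smash).
Proof.
rewrite /GRing.mul /= !smash_mulE; apply/ffunP=> s; rewrite !ffunE scaler_sumr.
by apply: eq_bigr => g _; rewrite linearZ scalerAr.
Qed.
HB.instance Definition _ := GRing.Lalgebra_isAlgebra.Build k smash smash_scaleAr.

Definition smash_incl (a : A) : smash := tens a 1.
Definition smash_coact : smash -> tensor G smash := @tens_comul A.

Lemma smash_inclE a : smash_incl a = [ffun=> a].
Proof. by apply/ffunP=> g; rewrite !ffunE scale1r. Qed.

Lemma smash_mulrE u v s :
  (u * v) s = \sum_g u g * alpha (delta (g * s^-1)%g) (v s).
Proof. by rewrite /GRing.mul /= smash_mulE ffunE. Qed.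

Lemma smash_coactE u g' g : smash_coact u g' g = u (g * g')%g.
Proof. by rewrite /smash_coact tens_comulE !ffunE. Qed.

Fact smash_incl_linear : linear smash_incl.
Proof. by move=> a b c; rewrite !smash_inclE; apply/ffunP=> g; rewrite !ffunE. Qed.
HB.instance Definition _ :=
  GRing.isLinear.Build k A smash *:%R smash_incl smash_incl_linear.

Lemma sum_delta_act s a : \sum_g alpha (delta (g * s^-1)%g) a = a.
Proof.
have := congr1 (fun u : smash => u s) (smash_mul1l [ffun=> a]).
rewrite /= smash_mulE !ffunE => {2}<-.
by apply: eq_bigr => g _; rewrite !ffunE scale1r mul1r.
Qed.

Fact smash_incl_monoid : monoid_morphism smash_incl.
Proof.
split=> // a b; apply/ffunP=> s; rewrite smash_mulrE !smash_inclE ffunE.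
by under eq_bigr => g _ do rewrite !ffunE; rewrite -mulr_sumr sum_delta_act.
Qed.
HB.instance Definition _ :=
  GRing.isMonoidMorphism.Build A smash smash_incl smash_incl_monoid.

Fact smash_incl_inj : injective smash_incl.
Proof. by move=> a b; rewrite !smash_inclE => /ffunP/(_ 1%g); rewrite !ffunE. Qed.

Fact smash_comodule : comodule_algebra smash_coact.
Proof.
split=> [a u v||u v|u|u].
- by apply/ffunP=> g'; apply/ffunP=> g; rewrite smash_coactE !ffunE !smash_coactE.
- by apply/ffunP=> g'; apply/ffunP=> g; rewrite smash_coactE !ffunE.
- apply/ffunP=> g'; apply/ffunP=> g; rewrite smash_coactE ffunE !smash_mulrE.
  rewrite (reindex_inj (mulIg g')) /=; apply: eq_bigr => r _.
  by rewrite !smash_coactE invMg mulgA mulgK.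
- rewrite tenslE tens_comulE; apply/ffunP=> g2; apply/ffunP=> g1; apply/ffunP=> g.
  by rewrite !ffunE !smash_coactE mulgA.
- rewrite /tfold (bigD1 1%g) //= big1 => [|g /negPf gn].
    rewrite addr0 /counit ffunE eqxx scale1r.
    by apply/ffunP=> s; rewrite smash_coactE mulg1.
  by rewrite /counit ffunE gn scale0r.
Qed.

Fact smash_coinv u : smash_coact u = tens u 1 <-> exists a, u = smash_incl a.
Proof.
split=> [/ffunP eq_u|[a ->]].
  exists (u 1%g); rewrite smash_inclE; apply/ffunP=> g; rewrite ffunE.
  move/(_ g): eq_u => /ffunP/(_ 1%g).
  by rewrite smash_coactE !ffunE scale1r mul1g.
by apply/ffunP=> g'; apply/ffunP=> g; rewrite smash_coactE !ffunE !scale1r.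
Qed.

Fact smash_cleaving : exists gamma : H -> smash,
  comodule_map smash_coact gamma /\ convolution_invertible gamma.
Proof.
have counitA h s : ((counit h)%:A : smash) s = (counit h)%:A.
  by rewrite !ffunE scale1r.
exists (tens 1); split; first split=> [a h l|h].
- by apply/ffunP=> g; rewrite !ffunE scalerDl scalerA.
- apply/ffunP=> g'; apply/ffunP=> g; rewrite smash_coactE tenslE.
  by rewrite !ffunE.
exists (fun h => tens 1 (antipode h)); split=> [a h l|h|h].
- by apply/ffunP=> g; rewrite !ffunE scalerDl scalerA.
- apply/ffunP=> s; rewrite counitA /convolution sum_ffunE (bigD1 s^-1%g) //=.
  rewrite [X in _ + X]big1 => [|g /negPf gn]; last first.
    rewrite smash_mulrE big1 // => r _.
    by rewrite !ffunE gn scale0r linear0 mulr0.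
  rewrite addr0 smash_mulrE (bigD1 s) //= big1 => [|g /negPf gn].
    by rewrite !ffunE eqxx scale1r act_delta_one mulgV eqxx mulr1 addr0.
  by rewrite !ffunE eqxx scale1r act_delta_one -eq_mulgV1 gn mulr0.
- apply/ffunP=> s; rewrite counitA /convolution sum_ffunE (bigD1 s) //=.
  rewrite [X in _ + X]big1 => [|g /negPf gn]; last first.
    rewrite smash_mulrE big1 // => r _.
    by rewrite !ffunE gn scale0r linear0 mulr0.
  rewrite addr0 smash_mulrE (bigD1 s) //= big1 => [|g /negPf gn].
    by rewrite !ffunE eqxx scale1r act_delta_one mulgV eqxx mulr1 addr0 mulVg.
  by rewrite !ffunE eqxx scale1r act_delta_one -eq_mulgV1 gn mulr0.
Qed.

Definition smash_product : cleft_extension A :=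
  @CleftExtension A smash smash_incl smash_coact
    smash_incl_inj smash_comodule smash_coinv smash_cleaving.

Lemma smash_productM (a b : A) (h l : H) :
  (tens a h : smash_product) * (tens b l : smash_product) =
  tfold (fun h1 h2 => tens (a * alpha h1 b) (h2 * l)) (comul h) :> smash_product.
Proof.
rewrite [LHS](_ : _ = smash_mul (tens a h) (tens b l)) // smash_mulE.
apply/ffunP=> s; rewrite ffunE sum_ffunE.
rewrite [RHS](bigD1 s) //= [X in _ = _ + X]big1 => [|r /negPf rn]; last first.
  by rewrite !ffunE rn mul0r scale0r.
rewrite addr0 [RHS]ffunE.
have -> : comul h s = \sum_g (h g : k) *: delta (g * s^-1)%g.
  apply/ffunP=> q; rewrite sum_ffunE /comul ffunE [LHS]ffunE (bigD1 (q * s)%g) //= big1.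
    by rewrite addr0 !ffunE mulgK eqxx /GRing.scale /= mulr1.
  move=> g gn; rewrite !ffunE; case: eqP => [qg|_]; last by rewrite /GRing.scale /= mulr0.
  by case/eqP: gn; rewrite -qg mulgKV.
rewrite -/(al _ _) linear_sum mulr_sumr scaler_sumr; apply: eq_bigr => g _.
rewrite linearZ /al /= !ffunE eqxx mul1r linearZ /=.
by rewrite -!scalerAr -!scalerAl scalerA mulrC -scalerA.
Qed.

End Smash.
End DualHopfAlgebra.

Definition generates (k : comNzRingType) (A : algType k) (a : A) : Prop :=
  forall b : A, exists q : {poly k}, b = horner_alg a q.

Section Local.
Variables (k : fieldType) (A : falgType k).

(* Every ideal is a k-subspace; these are the ideals when A is commutative. *)
Definition is_ideal (I : {vspace A}) : Prop := (fullv * I <= I)%VS.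
Definition maximal_ideal (I : {vspace A}) : Prop :=
  [/\ is_ideal I, I != fullv
    & forall J : {vspace A}, is_ideal J -> (I <= J)%VS -> J = I \/ J = fullv].
Definition local_algebra : Prop := exists! I : {vspace A}, maximal_ideal I.
End Local.

(* The n-fold direct power of the cyclic group of order p (written additively *)
(* by MathComp; p is prime below, so 'Z_p is Z/p). *)
Definition Cpn (p n : nat) : finGroupType := 'rV['Z_p]_n.

(* Main.v *)
(* Write [G = C_p^n] and identify [H] with the functions on [G].  An action of [H] *)
(* is a grading by [G], and a primitive generator [x] with [x^q = x], [q = p^n], is *)
(* an isomorphism of [G] onto the additive group of the field with [q] elements. *)
(* Cleft extensions: a cleaving gives [X] in [B] on which [g] acts by [X + x g].  Then *)
(* [X^q - X = a] is coinvariant, and an Artin-Schreier equation [c^q - c + a = 0] is *)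
(* solvable in [k[a]], so [y = X + c] satisfies [y^q = y]; interpolation at [y] yields *)
(* orthogonal idempotents of [B] indexed by [G], and [B] is the smash product for the *)
(* induced Peirce grading of [A]. *)
(* Classification: among the homogeneous components of [t], either some component of *)
(* degree [g <> 1] is a unit, whence a nilpotent generator [s] with [s + 1] homogeneous, *)
(* and applying the derivation [x] to [s^(dim A) = 0] forces [p | dim A]; or some *)
(* component [s] is itself a nilpotent generator.  The degree of [s + 1], respectively *)
(* [s], if not trivial, is moved to any other one by an automorphism of [G], scaling by *)
(* a nonzero element of the finite field.  The three smash products are told apart by *)
(* being commutative, and by whether the nilradical of [A] generates a two-sided ideal. *)

Require Import Defs.
From HB Require Import structures.
From mathcomp Require Import all_boot all_order all_algebra all_fingroup all_field.
Set Implicit Arguments.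
Unset Strict Implicit.
Unset Printing Implicit Defensive.
Import GRing.Theory.
Local Open Scope ring_scope.

(** * Nilpotent generators *)

(** For [G = C_p^n], an action of [k[G]^*] on [A] is a [G]-grading of [A], and a coaction on [B] is
    an action of [G] on [B] whose invariants are [A]. A primitive [x] is an additive character of
    [G]; if it generates and [x^q = x] with [q = p^n], it identifies [G] with the field [F_q] inside
    [k].

    Splitting. A cleaving yields [X] in [B] that [g] moves to [X + x g] ([cleft_translate]). Then
    [X^q - X] lies in [A], and adding a solution of an Artin-Schreier equation in [A]
    ([artin_schreier]) replaces [X] by some [y] with [y^q = y]. Lagrange polynomials evaluated at
    [y] are orthogonal idempotents permuted by [G]; they form an [A]-basis of [B] and exhibit it as
    a smash product ([cleft_is_smash], [cleft_twist_smash]).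

    Classification. A nilpotent generator identifies [A] with [k[X]/(X^d)], [d = dim A]. Every
    grading admits a nilpotent generator [s] such that [s] is homogeneous, or [s + 1] is homogeneous
    of nontrivial degree ([classification]); the second case forces [d = 0] in [k]
    ([dim_eq0_of_shifted]). Multiplication by [F_q^*] acts transitively on the nontrivial degrees,
    so [twist_of_generators] leaves at most three classes. The models exist because [X^d] is
    homogeneous, and so is [(X - 1)^d] when [p] divides [d] ([graded_quotient]). The trivial action
    is the one with commutative smash product; the other two are separated by
    [twist_stable_ideal]. *)

Lemma exprDn_comm_pchar (R : nzRingType) (p n : nat) (a b : R) :
    p \in [pchar R] -> a * b = b * a ->
  (a + b) ^+ (p ^ n) = a ^+ (p ^ n) + b ^+ (p ^ n).
Proof.
move=> hp ab; elim: n => [|n IHn]; first by rewrite expn0 !expr1.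
rewrite expnSr !exprM IHn -!(pFrobenius_autE hp) pFrobenius_autD_comm //.
exact/commrX/commr_sym/commrX.
Qed.

Lemma subX_pchar (R : comNzRingType) (p n : nat) (a b : R) :
    p \in [pchar R] -> (a - b) ^+ (p ^ n) = a ^+ (p ^ n) - b ^+ (p ^ n).
Proof.
move=> hp; apply/esym/eqP; rewrite subr_eq -exprDn_comm_pchar ?subrK //.
exact: mulrC.
Qed.

(** Newton interpolation: a new node is corrected by a multiple of the polynomial vanishing at the
    other nodes. Values are prescribed by a relation, which avoids choosing a function on [k]. *)
Lemma interpolation (k : fieldType) (s : seq k) (Q : k -> k -> Prop) :
  (forall z, exists y, Q z y) ->
  exists P : {poly k}, forall z, z \in s -> Q z P.[z].
Proof.
move=> exQ; elim: s => [|z s [P hP]]; first by exists 0.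
have [zs|zs] := boolP (z \in s).
  by exists P => w; rewrite inE => /predU1P [->|]; exact: hP.
have [y Qy] := exQ z; pose M := \prod_(w <- s) ('X - w%:P).
have Mz : M.[z] != 0 by move: zs; rewrite -root_prod_XsubC.
exists (P + ((y - P.[z]) / M.[z]) *: M) => w; rewrite inE => /predU1P [->|ws].
  by rewrite hornerD hornerZ divfK // addrC subrK.
suff -> : (P + ((y - P.[z]) / M.[z]) *: M).[w] = P.[w] by exact: hP.
have /eqP Mw : root M w by rewrite root_prod_XsubC.
by rewrite hornerD hornerZ Mw mulr0 addr0.
Qed.

Lemma coef0_XM (R : nzRingType) (P : {poly R}) :
  P`_0 = 0 -> P = 'X * drop_poly 1 P.
Proof.
by move=> P0; apply/polyP => -[|i]; rewrite coefXM ?coef_drop_poly //= addn1.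
Qed.

Lemma dvdp_XnP (k : fieldType) (d : nat) (P : {poly k}) :
  reflect (forall i, (i < d)%N -> P`_i = 0) ('X^d %| P).
Proof.
apply: (iffP idP) => [/dvdpP [Q ->] i id|P0]; first by rewrite coefMXn id.
apply/dvdpP; exists (drop_poly d P); rewrite -{1}(poly_take_drop d P).
rewrite -[RHS]add0r; congr (_ + _); apply/polyP => i.
by rewrite coef_take_poly coef0; case: ifP => // /P0.
Qed.

Section PolynomialValues.
Variables (k : comNzRingType) (A : algType k).
Implicit Types (a b : A) (P Q : {poly k}).

Lemma comm_horner_alg a b P : a * b = b * a -> horner_alg a P * b = b * horner_alg a P.
Proof.
move=> ab; elim/poly_ind: P => [|P c IHP]; first by rewrite !rmorph0 mul0r mulr0.
rewrite rmorphD rmorphM /= horner_algX horner_algC mulrDl mulrDr.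
by rewrite -mulrA ab !mulrA IHP mulr_algl mulr_algr.
Qed.

Lemma horner_alg_linear a c P Q :
  horner_alg a (c *: P + Q) = c *: horner_alg a P + horner_alg a Q.
Proof. by rewrite linearP /= mulr_algl. Qed.

Lemma horner_algZ a c P : horner_alg a (c *: P) = c *: horner_alg a P.
Proof. by rewrite linearZ /= mulr_algl. Qed.

Lemma horner_alg_comp a P Q : horner_alg a (P \Po Q) = horner_alg (horner_alg a Q) P.
Proof.
elim/poly_ind: P => [|P c IHP]; first by rewrite comp_poly0 !rmorph0.
by rewrite comp_polyD comp_polyM comp_polyX comp_polyC !rmorphD !rmorphM /=
   !horner_algX !horner_algC IHP.
Qed.

Lemma horner_alg_coef a P : horner_alg a P = \sum_(i < size P) P`_i *: a ^+ i.
Proof.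
rewrite -{1}[P]coefK poly_def rmorph_sum /=; apply: eq_bigr => i _.
by rewrite linearZ /= rmorphXn /= horner_algX mulr_algl.
Qed.
End PolynomialValues.

Lemma rmorph_horner_alg (k : comNzRingType) (A B : algType k) (f : {lrmorphism A -> B}) (a : A) P :
  f (horner_alg a P) = horner_alg (f a) P.
Proof.
rewrite !horner_alg_coef linear_sum.
apply: eq_bigr => i _.
by rewrite linearZ /= rmorphXn.
Qed.

Lemma generates_comm (k : comNzRingType) (A : algType k) (t : A) :
  generates t -> forall a b : A, a * b = b * a.
Proof.
by move=> gen a b; have [[P ->] [Q ->]] := (gen a, gen b); rewrite -!rmorphM mulrC.
Qed.

Lemma nilpotent_mul_neq1 (R : nzRingType) (t b : R) m :
  t * b = b * t -> t ^+ m = 0 -> t * b <> 1.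
Proof.
move=> tb tm /(congr1 (fun z => z ^+ m))/eqP.
by rewrite exprMn_comm // tm mul0r expr1n eq_sym oner_eq0.
Qed.

Lemma nilpotency_index (R : nzRingType) (t : R) m : t ^+ m = 0 ->
  exists2 e, t ^+ e = 0 & forall i, (i < e)%N -> t ^+ i != 0.
Proof.
move=> tm; have ex : exists m, t ^+ m == 0 by exists m; rewrite tm.
exists (ex_minn ex); case: ex_minnP => // e /eqP // _ min i.
by apply: contraTN => /min; rewrite ltnNge => ->.
Qed.

Section NilpotentGenerator.
Variables (k : fieldType) (A : falgType k).
Implicit Types (s t u v : A) (P Q : {poly k}).

(** If the coefficients of [P] below [i] vanish, multiplying [P(t)] by [t^(e-1-i)] leaves only the
    coefficient of index [i], times [t^(e-1)], which is nonzero. *)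
Lemma nilpotent_kernel t e P :
    t ^+ e = 0 -> (forall i, (i < e)%N -> t ^+ i != 0) ->
  reflect (horner_alg t P = 0) ('X^e %| P).
Proof.
move=> te tmin; apply: (iffP (dvdp_XnP _ _)) => [/dvdp_XnP/dvdpP [Q ->]|Pt].
  by rewrite rmorphM rmorphXn /= horner_algX te mulr0.
elim/ltn_ind => i IHi ie.
have /dvdp_XnP/dvdpP [Q defP] : forall j, (j < i)%N -> P`_j = 0.
  by move=> j ji; apply: IHi (ltn_trans ji ie).
have /eqP : t ^+ (e.-1 - i) * horner_alg t P = 0 by rewrite Pt mulr0.
have le : (i <= e.-1)%N by rewrite -ltnS (ltn_predK ie).
rewrite defP mulrC rmorphM rmorphXn /= horner_algX mulrA -exprD subnK //.
have -> : Q = 'X * drop_poly 1 Q + (Q`_0)%:P.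
  by apply/polyP => -[|j]; rewrite coefD coefXM coefC ?add0r ?addr0 //= coef_drop_poly addn1.
rewrite rmorphD rmorphM /= horner_algX horner_algC mulrDr mulr_algr.
rewrite mulrA -exprSr (ltn_predK ie) te mul0r add0r scaler_eq0.
rewrite (negPf (tmin _ _)) ?orbF ?(ltn_predK ie) // => /eqP Q0.
by rewrite coefXnM ltnn subnn coefD coefXM coefC Q0 add0r.
Qed.

(** Evaluation on polynomials of size at most [e], encoded as row vectors so that kernels and images
    have dimensions. *)
Let evf t e (v : 'rV[k]_e) : A := horner_alg t (rVpoly v).
Let evf_linear t e : linear (@evf t e).
Proof. by move=> c u v; rewrite /evf linearP horner_alg_linear. Qed.
HB.instance Definition _ t e :=
  GRing.isLinear.Build k _ _ _ (@evf t e) (@evf_linear t e).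
Let ev t e := linfun (@evf t e).

Let evE t e (v : 'rV_e) : ev t e v = horner_alg t (rVpoly v).
Proof. exact: lfunE. Qed.

Let ker_ev t e :
  (forall P, horner_alg t P = 0 -> 'X^e %| P) -> lker (ev t e) = 0%VS.
Proof.
move=> ker; apply/eqP/lker0P => u v; rewrite !evE => /eqP.
rewrite -subr_eq0 -raddfB /= -raddfB => /eqP /ker /dvdp_XnP uv.
apply/eqP; rewrite -subr_eq0; apply/eqP/rowP => i.
by rewrite -coef_rVpoly_ord uv // mxE.
Qed.

Let dim_ev t e :
  (forall P, horner_alg t P = 0 -> 'X^e %| P) -> \dim (limg (ev t e)) = e.
Proof. by move/ker_ev => ker; rewrite limg_dim_eq ?ker ?capv0 // dimvf /dim /= mul1n. Qed.

(** The powers of [t] below its nilpotency index form a basis of [A], so that index is [dim A]. *)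
Lemma generator_kernel t m P : generates t -> t ^+ m = 0 ->
  'X^(\dim {:A}) %| P <-> horner_alg t P = 0.
Proof.
move=> gen /nilpotency_index [e te tmin].
suff -> : \dim {:A} = e by split => /(nilpotent_kernel _ te tmin).
rewrite -(dim_ev (t := t) (e := e)) => [|Q /nilpotent_kernel]; last exact.
congr (\dim _); apply/esym/eqP; rewrite eqEsubv subvf; apply/subvP => a _.
have [Q ->] := gen a; rewrite -(poly_take_drop e Q) rmorphD rmorphM rmorphXn /=.
rewrite horner_algX te mulr0 addr0.
rewrite -(poly_rV_K (size_take_poly e Q)).
by have := memv_img (ev t e) (memvf (poly_rV (take_poly e Q))); rewrite evE.
Qed.

(** Evaluation is then injective on polynomials of degree below [dim A], hence surjective by
    dimension. *)
Lemma generates_kernel t : (forall P, horner_alg t P = 0 -> 'X^(\dim {:A}) %| P) ->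
  generates t.
Proof.
move=> ker a; have /eqP full : limg (ev t (\dim {:A})) == fullv.
  by rewrite -(geq_leqif (dimv_leqif_eq (subvf _))) dim_ev.
have /memv_imgP [v _ ->] : a \in limg (ev t (\dim {:A})) by rewrite full memvf.
by exists (rVpoly v); rewrite evE.
Qed.

(** With [Q = X W] and [W(0) != 0], the lowest term of [Q^i] has degree exactly [i], so the new
    element has the same nilpotency index [dim A] as [t]. *)
Lemma generates_linear_coef t m Q :
    generates t -> t ^+ m = 0 -> Q`_0 = 0 -> Q`_1 != 0 ->
  generates (horner_alg t Q).
Proof.
move=> gen tm Q0 Q1; have kert P := generator_kernel P gen tm.
have -> : Q = 'X * drop_poly 1 Q by exact: coef0_XM.
have W0 : (drop_poly 1 Q)`_0 != 0 by rewrite coef_drop_poly.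
move: (drop_poly 1 Q) W0 => W W0.
apply: generates_kernel => P /(nilpotent_kernel _ _ _); apply=> [|i id].
  by rewrite -rmorphXn; apply/kert; rewrite exprMn; exact: dvdp_mulIl.
rewrite -rmorphXn; apply/eqP => /kert/dvdp_XnP/(_ i id)/eqP.
by rewrite exprMn coefXnM ltnn subnn -horner_coef0 horner_exp horner_coef0 expf_eq0
   (negPf W0) andbF.
Qed.

(** If [P(t)] is nilpotent, [X] divides a power of [P], so [P] has no constant term: the nilradical
    is [t A]. *)
Lemma nilpotent_multiple t m s m' :
  generates t -> t ^+ m = 0 -> s ^+ m' = 0 -> exists a, s = t * a.
Proof.
move=> gen tm sm; have [P defs] := gen s.
exists (horner_alg t (drop_poly 1 P)); rewrite defs [in LHS](@coef0_XM _ P).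
  by rewrite rmorphM /= horner_algX.
move: sm; rewrite defs -rmorphXn => /(generator_kernel _ gen tm)/dvdp_XnP P0.
have dA : (0 < \dim {:A})%N by exact: adim_gt0.
by have /eqP := P0 0%N dA; rewrite -horner_coef0 horner_exp horner_coef0 expf_eq0
  => /andP [_ /eqP].
Qed.

Lemma shifted_kernel t m c P : generates t -> t ^+ m = 0 ->
  'X^(\dim {:A}) %| P \Po ('X + c%:P) <-> horner_alg (t + c%:A) P = 0.
Proof.
move=> gen tm; suff -> : horner_alg (t + c%:A) P = horner_alg t (P \Po ('X + c%:P)).
  exact: generator_kernel gen tm.
by rewrite horner_alg_comp rmorphD /= horner_algX horner_algC.
Qed.

Lemma generates_shift t c : generates t -> generates (t + c%:A).
Proof.
move=> gen a; have [P ->] := gen a; exists (P \Po ('X - c%:P)).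
by rewrite horner_alg_comp rmorphB /= horner_algX horner_algC addrK.
Qed.

Section GeneratorAut.
Variables (u v : A) (gen_u : generates u) (gen_v : generates v).
Hypothesis kerE : forall P, horner_alg u P = 0 <-> horner_alg v P = 0.

Fact generator_coord a : exists P, a == horner_alg u P.
Proof. by have [P ->] := gen_u a; exists P. Qed.

(** Substitution of [v] for [u] in any polynomial expression of [a]; [kerE] makes the result
    independent of the expression chosen. *)
Definition generator_map a := horner_alg v (xchoose (generator_coord a)).

Lemma generator_mapE P : generator_map (horner_alg u P) = horner_alg v P.
Proof.
apply/eqP; rewrite -subr_eq0 -rmorphB; apply/eqP/kerE/eqP.
by rewrite rmorphB subr_eq0 eq_sym (xchooseP (generator_coord _)).
Qed.

Fact generator_map_linear : linear generator_map.
Proof.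
move=> c a b; have [[P ->] [Q ->]] := (gen_u a, gen_u b).
by rewrite -horner_alg_linear !generator_mapE horner_alg_linear.
Qed.
HB.instance Definition _ :=
  GRing.isLinear.Build k A A *:%R generator_map generator_map_linear.

Fact generator_map_monoid : monoid_morphism generator_map.
Proof.
split=> [|a b]; first by have := generator_mapE 1; rewrite !rmorph1.
have [[P ->] [Q ->]] := (gen_u a, gen_u b).
by rewrite -rmorphM !generator_mapE rmorphM.
Qed.
HB.instance Definition _ :=
  GRing.isMonoidMorphism.Build A A generator_map generator_map_monoid.

Lemma generator_aut : exists phi : {lrmorphism A -> A},
  bijective phi /\ forall P, phi (horner_alg u P) = horner_alg v P.
Proof.
have coord a : exists P, a == horner_alg v P.
  by have [P ->] := gen_v a; exists P.
exists generator_map; split; last exact: generator_mapE.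
exists (fun a => horner_alg u (xchoose (coord a))) => a.
  have [P ->] := gen_u a; rewrite /= generator_mapE.
  apply/eqP; rewrite -subr_eq0 -rmorphB; apply/eqP/kerE/eqP.
  by rewrite rmorphB subr_eq0 eq_sym (xchooseP (coord _)).
by rewrite /= generator_mapE; exact/esym/eqP/(xchooseP (coord a)).
Qed.
End GeneratorAut.
End NilpotentGenerator.

(** * Artin-Schreier equations *)

Lemma annihilating_poly (k : fieldType) (A : falgType k) (a : A) :
  exists2 P : {poly k}, P != 0 & horner_alg a P = 0.
Proof.
pose f (v : 'rV[k]_(\dim {:A}).+1) : A := horner_alg a (rVpoly v).
have linf : linear f by move=> c u v; rewrite /f linearP horner_alg_linear.
pose F : {linear 'rV[k]_(\dim {:A}).+1 -> A} :=
  HB.pack f (GRing.isLinear.Build _ _ _ _ f linf).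
have ker0 : lker (linfun F) != 0%VS.
  apply/eqP => ker; have := dimvS (subvf (limg (linfun F))).
  by rewrite limg_dim_eq ?ker ?capv0 // dimvf /dim /= mul1n ltnn.
exists (rVpoly (vpick (lker (linfun F)))).
  apply: contraNneq ker0 => v0.
  by rewrite -vpick0 -(inj_eq (can_inj rVpolyK)) v0 linear0.
by have := memv_pick (lker (linfun F)); rewrite memv_ker lfunE => /eqP.
Qed.

Section ArtinSchreier.
Variables (k : closedFieldType) (p n : nat) (hp : p \in [pchar k]) (hn : (0 < n)%N).
Local Notation q := (p ^ n)%N.
Local Notation AS P := (P ^+ q - P).

Lemma pchar_expn_gt1 : (1 < q)%N.
Proof. by rewrite -{1}(expn0 p) ltn_exp2l ?(prime_gt1 (pcharf_prime hp)). Qed.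

Lemma size_XqsubX (R : nzRingType) : size (AS 'X : {poly R}) = q.+1.
Proof.
by rewrite size_polyDl size_polyXn // size_polyN size_polyX ltnS pchar_expn_gt1.
Qed.

Lemma monic_XqsubX (R : nzRingType) : (AS 'X : {poly R}) \is monic.
Proof.
by rewrite monicE lead_coefDl ?lead_coefXn // size_polyXn size_polyN size_polyX
  ltnS pchar_expn_gt1.
Qed.

Lemma artin_schreier_root (z : k) : exists y, AS y + z = 0.
Proof.
have /closed_rootP [y] : size (AS 'X + z%:P) != 1%N.
  rewrite size_polyDl ?size_XqsubX ?eqSS -?lt0n; first exact: ltnW pchar_expn_gt1.
  by rewrite (leq_ltn_trans (size_polyC_leq1 _)) // ltnS (ltnW pchar_expn_gt1).
by rewrite rootE !hornerE => /eqP ?; exists y.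
Qed.

(* First solve at the eigenvalues of [a] by interpolation; what remains is a *)
(* nilpotent [N a], absorbed by the finite geometric series of Frobenius *)
(* powers [N + N^q + N^(q^2) + ...]. *)
Lemma artin_schreier (A : falgType k) (a : A) :
  exists C : {poly k}, horner_alg a (AS C + 'X) = 0.
Proof.
have [P P0 Pa] := annihilating_poly a.
have [r defP] := closed_field_poly_normal P.
have {Pa} Pa : horner_alg a (\prod_(z <- r) ('X - z%:P)) = 0.
  apply/eqP; have /eqP := Pa; rewrite defP horner_algZ.
  by rewrite scaler_eq0 lead_coef_eq0 (negPf P0).
have [C0 hC0] := interpolation r artin_schreier_root.
pose N := AS C0 + 'X; pose m := size r.
(* Every root in [r] is a root of [N], so the product of the [m] linear factors, multiplicities
   included, divides [N^m]. *)
have Na : horner_alg a (N ^+ m) = 0.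
  suff /dvdpP [Q ->] : \prod_(z <- r) ('X - z%:P) %| N ^+ m by rewrite rmorphM /= Pa mulr0.
  rewrite /m; elim: (r) hC0 => [|z s IHs] hC0; first by rewrite big_nil dvd1p.
  rewrite big_cons exprS; apply: dvdp_mul; last first.
    by apply: IHs => w ws; apply: hC0; rewrite inE ws orbT.
  by rewrite dvdp_XsubCl rootE !hornerE; apply/eqP/hC0; rewrite inE eqxx.
pose S := \sum_(j < m) N ^+ (q ^ j).
have hpP : p \in [pchar {poly k}] by rewrite pchar_poly.
have SE : AS S = N ^+ (q ^ m) - N.
  rewrite /S -(big_mkord xpredT (fun j => N ^+ (q ^ j))); elim: (m) => [|i IHi].
    by rewrite big_geq // expn0 expr1 expr0n eqn0Ngt (ltnW pchar_expn_gt1) !subrr.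
  rewrite big_nat_recr //= exprDn_comm_pchar 1?mulrC // opprD addrACA IHi.
  by rewrite -exprM -expnSr addrC addrA subrK.
exists (C0 + S); rewrite exprDn_comm_pchar 1?mulrC // opprD addrACA SE.
rewrite (_ : _ + 'X = N + (N ^+ (q ^ m) - N)); last by rewrite [LHS]addrAC.
rewrite subrKC.
suff lem : (m <= q ^ m)%N by rewrite -(subnK lem) exprD rmorphM /= Na mulr0.
exact/ltnW/ltn_expl/pchar_expn_gt1.
Qed.

(** The derivative of [X^q - X] is [-1], so its [q] roots are distinct: they form the copy of [F_q]
    in [k]. *)
Lemma XqsubX_split : exists r : seq k,
  [/\ uniq r, size r = q & AS 'X = \prod_(z <- r) ('X - z%:P) :> {poly k}].
Proof.
have [r] := closed_field_poly_normal (AS 'X : {poly k}).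
rewrite (monicP (monic_XqsubX _)) scale1r => defr; exists r; split=> //.
  rewrite -separable_prod_XsubC -defr unlock derivB derivXn derivX.
  rewrite -mulr_natr natrX.
  have -> : p%:R = 0 :> {poly k} by rewrite -(rmorph_nat polyC) (pcharf0 hp).
  rewrite expr0n eqn0Ngt hn mulr0 sub0r.
  by rewrite -(@coprimepZr _ (-1)) ?oppr_eq0 ?oner_eq0 // scaleN1r opprK coprimep1.
by apply/succn_inj; rewrite -(size_XqsubX k) defr size_prod_XsubC.
Qed.

Lemma natr_fixed (i : nat) : (i%:R : k) ^+ q = i%:R.
Proof.
elim: (n) => [|m IHm]; first by rewrite expn0 expr1.
by rewrite expnSr exprM IHm -(pFrobenius_autE hp) pFrobenius_aut_nat.
Qed.

Lemma natr_eq0_pchar (i : nat) : (i%:R == 0 :> k) = (p %| i)%N.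
Proof. by rewrite (dvdn_pcharf hp). Qed.

(** A basis of [F_q] over [F_p] is built by counting: the span of [m < n] elements has at most
    [p^m < q] members, so some root of [X^q - X] lies outside. Scalars of [F_p] are represented by
    natural numbers. *)
Lemma independent_fixed m : (m <= n)%N -> exists w : nat -> k,
  (forall j, w j ^+ q = w j) /\
  forall c : nat -> nat, \sum_(j < m) (c j)%:R * w j = 0 ->
    forall j, (j < m)%N -> (p %| c j)%N.
Proof.
have pr_p := pcharf_prime hp; have p_gt0 := prime_gt0 pr_p.
elim: m => [_|m IHm mn].
  exists (fun=> 0); split=> // j.
  by rewrite expr0n eqn0Ngt (ltnW pchar_expn_gt1).
have [w [wfix indep]] := IHm (ltnW mn).
pose span := [seq \sum_(j < m) (c j : 'I_p)%:R * w j | c : {ffun 'I_m -> 'I_p}].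
have [r [uniq_r size_r defr]] := XqsubX_split.
have [z zr zspan] : exists2 z, z \in r & z \notin span.
  apply/hasP; rewrite -[has _ _]negbK -all_predC; apply/negP => /allP sub.
  have /(uniq_leq_size uniq_r) : {subset r <= span}.
    by move=> z /sub /=; rewrite negbK.
  rewrite size_r size_map -cardE card_ffun !card_ord leq_exp2l ?prime_gt1 //.
  by rewrite leqNgt mn.
have zfix : z ^+ q = z.
  apply/eqP; rewrite -subr_eq0; have := zr.
  by rewrite -root_prod_XsubC -defr rootE !hornerE.
pose w' j := if j == m then z else w j.
have w'E (c : nat -> nat) : \sum_(j < m) (c j)%:R * w' j = \sum_(j < m) (c j)%:R * w j.
  by apply: eq_bigr => j _; rewrite /w' (ltn_eqF (ltn_ord j)).
exists w'; split=> [j|c]; first by rewrite /w'; case: eqP.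
rewrite big_ord_recr /= w'E {1}/w' eqxx => rel.
suff pcm : (p %| c m)%N.
  move=> j; rewrite ltnS leq_eqVlt => /predU1P [->|] //; apply: indep.
  by move: rel; rewrite (eqP (_ : (c m)%:R == 0)) ?natr_eq0_pchar // mul0r addr0.
apply: contraR zspan => pcm.
have cm_gt0 : (0 < c m)%N by case: (c m) pcm => //; rewrite dvdn0.
have [u v def_u _] := egcdnP p cm_gt0.
have u_inv : u%:R * (c m)%:R = 1 :> k.
  rewrite -natrM def_u natrD natrM (pcharf0 hp) mulr0 add0r gcdnC.
  by move: pcm; rewrite -prime_coprime // => /eqP ->.
(* As [u] inverts [c m] modulo [p] and [p - 1] stands for [-1], [d j] represents [- c j / c m], the
   coefficient of [w j] in the expression of [z]. *)
pose d j := (u * (p - 1) * c j)%N.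
apply/mapP; exists [ffun j : 'I_m => Ordinal (ltn_pmod (d j) p_gt0)].
  by rewrite mem_enum.
have pm1 : (p - 1)%:R = -1 :> k by rewrite natrB // (pcharf0 hp) sub0r.
under eq_bigr => j _ do
  rewrite ffunE /= (GRing.natr_mod_pchar hp) /d !natrM pm1 mulrN1 !mulNr -mulrA.
rewrite sumrN -mulr_sumr; have /eqP := rel.
by rewrite addr_eq0 => /eqP ->; rewrite mulrN opprK mulrA u_inv mul1r.
Qed.

End ArtinSchreier.

(** * Gradings and twist equivalences of smash products *)

Lemma comulE (k : comNzRingType) (G : finGroupType) (h : dualgrp k G) g' g :
  comul h g' g = h (g * g')%g.
Proof. by rewrite !ffunE. Qed.

Lemma deltaE (k : comNzRingType) (G : finGroupType) (g s : G) :
  delta k g s = (g == s)%:R :> k.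
Proof. by rewrite ffunE. Qed.

Section Homogeneous.
Variables (k : comNzRingType) (G : finGroupType) (A : algType k).
Variable alpha : module_algebra G A.
Implicit Types (a b : A) (g : G) (h l : dualgrp k G).

(* An action of [k[G]^*] is a [G]-grading: [alpha h] is [h g] in degree [g], *)
(* and [alpha (delta g)] is the projection onto degree [g]. *)
Definition homogeneous g a := forall h, alpha h a = (h g : k) *: a.

Lemma act_sumr h I (r : seq I) (F : I -> A) :
  alpha h (\sum_(i <- r) F i) = \sum_(i <- r) alpha h (F i).
Proof. exact: linear_sum. Qed.

Lemma act_suml I (r : seq I) (F : I -> dualgrp k G) a :
  alpha (\sum_(i <- r) F i) a = \sum_(i <- r) alpha (F i) a.
Proof.
pose L : {linear dualgrp k G -> A} :=
  HB.pack (fun h => alpha h a) (GRing.isLinear.Build _ _ _ _ _ (act_linearl alpha a)).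
exact: (linear_sum L).
Qed.

Lemma actZl c h a : alpha (c *: h) a = c *: alpha h a.
Proof.
pose L : {linear dualgrp k G -> A} :=
  HB.pack (fun h => alpha h a) (GRing.isLinear.Build _ _ _ _ _ (act_linearl alpha a)).
exact: (linearZ_LR L).
Qed.

Lemma actDl h l a : alpha (h + l) a = alpha h a + alpha l a.
Proof. by have := act_linearl alpha a 1 h l; rewrite !scale1r. Qed.

Lemma sum_delta : \sum_(g : G) delta k g = 1.
Proof.
apply/ffunP=> s; rewrite sum_ffunE !ffunE (bigD1 s) //= ffunE eqxx big1 ?addr0 //.
by move=> g /negPf gs; rewrite ffunE gs.
Qed.

Lemma sum_act_delta a : a = \sum_(g : G) alpha (delta k g) a.
Proof. by rewrite -act_suml sum_delta act_1. Qed.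

Lemma mul_delta h g : h * delta k g = (h g : k) *: delta k g.
Proof.
apply/ffunP=> s; rewrite !ffunE; case: eqP => [<-|_]; first by rewrite /GRing.scale /= !mulr1.
by rewrite /GRing.scale /= !mulr0.
Qed.

Lemma homogeneous_delta g a : homogeneous g (alpha (delta k g) a).
Proof. by move=> h; rewrite -act_M mul_delta actZl. Qed.

Lemma homogeneous_act_delta g g' a :
  homogeneous g a -> alpha (delta k g') a = (g' == g)%:R *: a.
Proof. by move->; rewrite ffunE. Qed.

Lemma homogeneous1 : homogeneous 1%g 1.
Proof. by move=> h; rewrite act_one. Qed.

Lemma homogeneousZ g c a : homogeneous g a -> homogeneous g (c *: a).
Proof. by move=> ha h; rewrite linearZ /= ha !scalerA mulrC. Qed.

Lemma homogeneousM g g' a b :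
  homogeneous g a -> homogeneous g' b -> homogeneous (g * g')%g (a * b).
Proof.
move=> ha hb h; rewrite act_mul /tfold (bigD1 g') //= big1 ?addr0 => [|r /negPf rg].
  by rewrite ha hb !ffunE eqxx scale1r scalerAl.
by rewrite (homogeneous_act_delta r hb) rg scale0r mulr0.
Qed.

Lemma homogeneousX g a i : homogeneous g a -> homogeneous (g ^+ i)%g (a ^+ i).
Proof.
move=> ha; elim: i => [|i IHi]; first exact: homogeneous1.
by rewrite exprS expgS; exact: homogeneousM.
Qed.

Lemma act_primitive (x : dualgrp k G) a b :
  primitive x -> alpha x (a * b) = alpha x a * b + a * alpha x b.
Proof.
move=> prim; rewrite act_mul /tfold.
(* Evaluating the primitivity of [x] at [g] splits [comul x g] as [x] plus the scalar [x g]; summing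
   over degrees gives one Leibniz term from each part. *)
under eq_bigr => g _.
  have -> : comul x g = x + (x g : k) *: 1.
    by rewrite prim !ffunE scale1r.
  rewrite actDl actZl act_1 mulrDl -scalerAl scalerAr -actZl.
  over.
by rewrite big_split -!mulr_sumr -sum_act_delta -act_suml -dual_delta.
Qed.

Lemma act_horner_alg h g u P : homogeneous g u ->
  alpha h (horner_alg u P) = \sum_(i < size P) (h (g ^+ i)%g * P`_i) *: u ^+ i.
Proof.
move=> hu; rewrite horner_alg_coef act_sumr; apply: eq_bigr => i _.
by rewrite linearZ /= (homogeneousX i hu) scalerA mulrC.
Qed.

Lemma cleft_inclE a :
  cleft_incl (smash_product alpha) a = [ffun=> a] :> tensor G A.
Proof. exact: smash_inclE. Qed.

Lemma smash_mul_incl (u : smash_product alpha) a s :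
  (u * cleft_incl _ a : tensor G A) s =
  \sum_g (u : tensor G A) g * alpha (delta k (g * s^-1)%g) a.
Proof. by rewrite smash_mulrE cleft_inclE; under eq_bigr do rewrite ffunE. Qed.

Lemma smash_incl_mul (u : smash_product alpha) a s :
  (cleft_incl _ a * u : tensor G A) s = a * (u : tensor G A) s.
Proof.
rewrite smash_mulrE cleft_inclE; under eq_bigr do rewrite ffunE.
by rewrite -mulr_sumr sum_delta_act.
Qed.

(** This is [1 # delta g]. Multiplied on the right by an element of [A], it displays the homogeneous
    components of that element. *)
Definition column g : smash_product alpha := [ffun r => (r == g)%:R] : tensor G A.

Lemma column_mul_incl g a s :
  (column g * cleft_incl _ a : tensor G A) s = alpha (delta k (g * s^-1)%g) a.
Proof.
rewrite smash_mul_incl (bigD1 g) //= ffunE eqxx mul1r big1 ?addr0 // => r /negPf rg.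
by rewrite ffunE rg mul0r.
Qed.

(** Comparing the two products of [1 # delta g] with [a] at the identity of [G] shows that [a] has
    no component in a degree [g != 1]. *)
Lemma commutative_smash_trivial :
    (forall u v : smash_product alpha, u * v = v * u) ->
  forall h a, alpha h a = (h 1%g : k) *: a.
Proof.
move=> comm h a; rewrite [h in LHS]dual_delta act_suml (bigD1 1%g) //= big1.
  rewrite actZl addr0; congr (_ *: _).
  have /ffunP/(_ 1%g) := comm (column 1%g) (cleft_incl _ a).
  by rewrite column_mul_incl smash_incl_mul ffunE eqxx mulr1 mulgV.
move=> g /negPf g1; rewrite actZl; have /ffunP/(_ 1%g) := comm (column g) (cleft_incl _ a).
rewrite column_mul_incl smash_incl_mul ffunE eq_sym g1 mulr0 invg1 mulg1 => ->.
by rewrite scaler0.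
Qed.

(** For the trivial grading the smash product multiplies functions [G -> A] pointwise. *)
Lemma trivial_smash_commutative : (forall a b, a * b = b * a) ->
    (forall h a, alpha h a = (h 1%g : k) *: a) ->
  forall u v : smash_product alpha, u * v = v * u.
Proof.
move=> comm triv u v; apply/ffunP=> s.
have E (w w' : smash_product alpha) :
    (w * w' : tensor G A) s = (w : tensor G A) s * (w' : tensor G A) s.
  rewrite smash_mulrE (bigD1 s) //= big1 ?addr0 => [|g gs].
    by rewrite triv mulgV ffunE eqxx scale1r.
  by rewrite triv ffunE -eq_mulgV1 (negPf gs) scale0r mulr0.
by rewrite !E comm.
Qed.
End Homogeneous.

(** * Group automorphisms and the twist equivalences they induce *)

Section Relabelling.
Variables (k : comNzRingType) (G : finGroupType) (sigma : G -> G).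
Hypothesis sigmaM : {morph sigma : g g' / (g * g')%g}.
Hypothesis sigma_inj : injective sigma.

Definition relabel (M : Type) (u : tensor G M) : tensor G M := [ffun g => u (sigma g)].
Local Arguments relabel {M} u.
Local Notation H := (dualgrp k G).

Fact relabel_linear : linear (relabel : H -> H).
Proof. by move=> c u v; apply/ffunP=> g; rewrite !ffunE. Qed.
HB.instance Definition _ :=
  GRing.isLinear.Build k H H *:%R (relabel : H -> H) relabel_linear.

Fact relabel_monoid : monoid_morphism (relabel : H -> H).
Proof. by split=> [|u v]; apply/ffunP=> g; rewrite !ffunE. Qed.
HB.instance Definition _ :=
  GRing.isMonoidMorphism.Build H H (relabel : H -> H) relabel_monoid.

Lemma tensr_relabel (M : lmodType k) (T : tensor G M) :
  tensr (relabel : H -> H) T = relabel T.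
Proof.
apply/ffunP=> s; rewrite sum_ffunE (bigD1 (sigma s)) //= big1 ?addr0.
  by rewrite !ffunE eqxx scale1r.
by move=> g /negPf gs; rewrite !ffunE gs scale0r.
Qed.

Lemma relabel_hopf : hopf_automorphism (relabel : {lrmorphism H -> H}).
Proof.
split=> [||h].
- exists (fun u : H => [ffun g => u (invF sigma_inj g)] : H) => u; apply/ffunP=> g.
    by rewrite !ffunE f_invF.
  by rewrite !ffunE invF_f.
- move=> h; rewrite tensr_relabel tenslE; apply/ffunP=> g'; apply/ffunP=> g.
  by rewrite !ffunE sigmaM.
- by rewrite /counit ffunE; congr (h _); apply: (mulgI (sigma 1)); rewrite -sigmaM !mulg1.
Qed.
End Relabelling.
Arguments relabel {G} sigma {M} u.

Section SmashTwist.
Variables (k : comNzRingType) (G : finGroupType) (A : algType k).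
Variables (beta alpha : module_algebra G A) (phi : {lrmorphism A -> A}).
Variables (sigma : G -> G) (sigmaM : {morph sigma : g g' / (g * g')%g}).
Hypotheses (sigma_inj : injective sigma) (phi_bij : bijective phi).
Hypothesis phi_act : forall g a,
  phi (beta (delta k (sigma g)) a) = alpha (delta k g) (phi a).

Definition smash_twist_map (u : smash_product beta) : smash_product alpha :=
  [ffun g => phi ((u : tensor G A) (sigma g))] : tensor G A.

Fact smash_twist_linear : linear smash_twist_map.
Proof. by move=> c u v; apply/ffunP=> g; rewrite !ffunE linearP. Qed.
HB.instance Definition _ := GRing.isLinear.Build k (smash_product beta)
  (smash_product alpha) *:%R smash_twist_map smash_twist_linear.

Let sigmaV g : sigma g^-1%g = (sigma g)^-1%g.
Proof.
apply: (mulgI (sigma g)); rewrite -sigmaM !mulgV.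
by apply: (mulgI (sigma 1)); rewrite -sigmaM !mulg1.
Qed.

Fact smash_twist_monoid : monoid_morphism smash_twist_map.
Proof.
split=> [|u v]; apply/ffunP=> s.
  by rewrite !ffunE !scale1r rmorph1.
rewrite ffunE !smash_mulrE rmorph_sum (reindex_inj sigma_inj) /=.
apply: eq_bigr => g _; rewrite rmorphM /= !ffunE.
by rewrite -sigmaV -sigmaM phi_act.
Qed.
HB.instance Definition _ := GRing.isMonoidMorphism.Build (smash_product beta)
  (smash_product alpha) smash_twist_map smash_twist_monoid.

(** The map precomposes with [sigma], whereas the definition of twist equivalence puts the Hopf
    automorphism on the coaction of the target; hence relabelling by the inverse of [sigma]. *)
Lemma smash_twist : twist_equivalent (smash_product beta) (smash_product alpha).
Proof.
have tau_inj : injective (invF sigma_inj) := can_inj (f_invF sigma_inj).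
have tauM : {morph invF sigma_inj : g g' / (g * g')%g}.
  by move=> g g'; apply: sigma_inj; rewrite sigmaM !f_invF.
exists phi, (relabel (invF sigma_inj) : {lrmorphism dualgrp k G -> dualgrp k G}).
exists smash_twist_map; split=> //.
- exact: relabel_hopf.
- case: phi_bij => psi phiK psiK.
  exists (fun v => [ffun g => psi ((v : tensor G A) (invF sigma_inj g))] : tensor G A) => u;
    apply/ffunP=> g; rewrite !ffunE.
    by rewrite f_invF phiK.
  by rewrite invF_f psiK.
- move=> a b; apply/ffunP=> s.
  by rewrite smash_incl_mul !ffunE -rmorphM; congr (phi _); rewrite smash_incl_mul.
move=> b; rewrite tensr_relabel tenslE; apply/ffunP=> g'; apply/ffunP=> g.
by rewrite !ffunE !smash_coactE !ffunE sigmaM f_invF.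
Qed.
End SmashTwist.

(** * Gradings on quotients of [k[X]] by a homogeneous polynomial *)

Section GradedQuotient.
Variables (k : fieldType) (G : finGroupType) (A : falgType k).
Variables (u : A) (g1 g0 : G) (M : {poly k}) (gen : generates u).
Hypothesis kerM : forall P, M %| P <-> horner_alg u P = 0.
Hypothesis homM : forall i, M`_i != 0 -> (g1 ^+ i)%g = g0.
Local Notation H := (dualgrp k G).
Implicit Types (P Q : {poly k}) (h l : H).

(* The action on [k[X]] for which [X] has degree [g1]. *)
Definition poly_act h P := \poly_(i < size P) ((h (g1 ^+ i)%g : k) * P`_i).

Lemma coef_poly_act h P i : (poly_act h P)`_i = h (g1 ^+ i)%g * P`_i.
Proof. by rewrite coef_poly; case: ltnP => // /(nth_default _) ->; rewrite mulr0. Qed.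

Lemma poly_actM h P Q : poly_act h (P * Q) =
  \sum_g poly_act (comul h g) P * poly_act (delta k g) Q.
Proof.
apply/polyP => m; rewrite coef_poly_act coefM coef_sum mulr_sumr.
under [RHS]eq_bigr do rewrite coefM.
rewrite exchange_big /=; apply: eq_bigr => i _.
rewrite (bigD1 (g1 ^+ (m - i))%g) //= big1 ?addr0 => [|g /negPf gi].
  rewrite !coef_poly_act comulE deltaE eqxx mul1r -expgnDr subnKC ?leq_ord //.
  by rewrite mulrA.
by rewrite !coef_poly_act deltaE gi mul0r mulr0.
Qed.

(** [homM] says that [M] is homogeneous of degree [g0]; passing [M] therefore only translates [h] by
    [g0], and the ideal generated by [M] is stable under the action. *)
Lemma poly_act_eigen h Q :
  poly_act h (M * Q) = M * poly_act [ffun g => h (g0 * g)%g] Q.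
Proof.
apply/polyP => m; rewrite coef_poly_act !coefM mulr_sumr; apply: eq_bigr => i _.
have [->|/homM g0i] := eqVneq M`_i 0; first by rewrite !mul0r mulr0.
by rewrite coef_poly_act ffunE -g0i -expgnDr subnKC ?leq_ord // mulrCA.
Qed.

Lemma poly_act_linear h c P Q :
  poly_act h (c *: P + Q) = c *: poly_act h P + poly_act h Q.
Proof. by apply/polyP => i; rewrite !(coefD, coefZ, coef_poly_act) mulrDr mulrCA. Qed.

Fact graded_coord a : exists P, a == horner_alg u P.
Proof. by have [P ->] := gen a; exists P. Qed.

Definition graded_act h a := horner_alg u (poly_act h (xchoose (graded_coord a))).

Lemma graded_actE h P : graded_act h (horner_alg u P) = horner_alg u (poly_act h P).
Proof.
apply/eqP; rewrite -subr_eq0 -rmorphB /=; apply/eqP.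
rewrite addrC -scaleN1r -poly_act_linear; apply/kerM.
set Q := xchoose _; suff /dvdpP [R ->] : M %| -1 *: P + Q.
  by rewrite mulrC poly_act_eigen dvdp_mulIl.
apply/kerM; rewrite horner_alg_linear scaleN1r.
by rewrite -(eqP (xchooseP (graded_coord (horner_alg u P)))) addNr.
Qed.

Fact graded_act_linearl a : linear (graded_act^~ a).
Proof.
have [P ->] := gen a; move=> c h l; rewrite !graded_actE -horner_alg_linear.
congr (horner_alg _ _); apply/polyP => i.
by rewrite !(coefD, coefZ, coef_poly_act) !ffunE mulrDl mulrA.
Qed.

Fact graded_act_linearr h : linear (graded_act h).
Proof.
move=> c a b; have [[P ->] [Q ->]] := (gen a, gen b).
by rewrite -horner_alg_linear !graded_actE poly_act_linear horner_alg_linear.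
Qed.

Fact graded_act_1 a : graded_act 1 a = a.
Proof.
have [P ->] := gen a; rewrite graded_actE; congr (horner_alg _ _).
by apply/polyP => i; rewrite coef_poly_act ffunE mul1r.
Qed.

Fact graded_act_M h l a : graded_act (h * l) a = graded_act h (graded_act l a).
Proof.
have [P ->] := gen a; rewrite (graded_actE (h * l)) (graded_actE l) (graded_actE h).
congr (horner_alg _ _); apply/polyP => i.
by rewrite !coef_poly_act ffunE mulrA.
Qed.

Fact graded_act_mul h a b : graded_act h (a * b) =
  tfold (fun h1 h2 => graded_act h1 a * graded_act h2 b) (comul h).
Proof.
have [[P ->] [Q ->]] := (gen a, gen b).
rewrite -rmorphM graded_actE poly_actM rmorph_sum; apply: eq_bigr => g _.
by rewrite rmorphM !graded_actE.
Qed.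

Fact graded_act_one h : graded_act h 1 = (counit h)%:A.
Proof.
have := graded_actE h 1; rewrite rmorph1 => ->.
rewrite -(horner_algC u); congr (horner_alg _ _); apply/polyP => i.
by rewrite coef_poly_act coef1 coefC; case: i => [|i]; rewrite ?mulr1 ?mulr0.
Qed.

Lemma graded_quotient : exists alpha : module_algebra G A, homogeneous alpha g1 u.
Proof.
exists (ModuleAlgebra graded_act_linearl graded_act_linearr graded_act_1
  graded_act_M graded_act_mul graded_act_one) => h /=.
have := graded_actE h 'X; rewrite horner_algX => ->.
rewrite -[u in RHS]horner_algX -horner_algZ; congr (horner_alg _ _); apply/polyP => i.
rewrite coef_poly_act coefZ coefX.
by case: eqP => [->|_]; rewrite ?mulr0 // expg1.
Qed.
End GradedQuotient.

Section ShiftedGenerator.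
Variables (k : fieldType) (G : finGroupType) (A : falgType k).
Variables (t : A) (m : nat) (gen : generates t) (tm : t ^+ m = 0).
Local Notation d := (\dim {:A}).

Lemma shifted_kernelE c P :
  ('X - c%:P) ^+ d %| P <-> horner_alg (t + c%:A) P = 0.
Proof.
apply: iff_trans (shifted_kernel c P gen tm).
have XcK Q : (Q \Po ('X - c%:P)) \Po ('X + c%:P) = Q.
  by rewrite -comp_polyA comp_polyB comp_polyX comp_polyC addrK comp_polyXr.
have XcK' Q : (Q \Po ('X + c%:P)) \Po ('X - c%:P) = Q.
  by rewrite -comp_polyA comp_polyD comp_polyX comp_polyC subrK comp_polyXr.
split=> /dvdpP [Q].
  move=> ->; rewrite comp_polyM rmorphXn /= comp_polyB comp_polyX comp_polyC addrK.
  exact: dvdp_mulIr.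
move=> /(congr1 (fun R => R \Po ('X - c%:P))); rewrite XcK' => ->.
by rewrite comp_polyM rmorphXn /= comp_polyX dvdp_mulIr.
Qed.

(** The relation [X^d = 0] is a monomial, hence homogeneous whatever the degree [g] given to [X]. *)
Lemma graded_generator (g : G) : exists alpha : module_algebra G A, homogeneous alpha g t.
Proof.
rewrite -[t]addr0 -(scale0r 1).
have gen0 : generates (t + 0%:A) := generates_shift 0 gen.
apply: (graded_quotient gen0 (shifted_kernelE 0) (g0 := (g ^+ d)%g)) => i.
by rewrite subr0 coefXn; case: (i =P d) => [->|]; rewrite ?eqxx.
Qed.

(* In characteristic [p] with [d = p e], [(X - 1)^d = (X^p - 1)^e] is homogeneous *)
(* as soon as [g^p = 1]. *)
Lemma graded_shifted_generator p (g : G) :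
    p \in [pchar k] -> (g ^+ p)%g = 1%g -> (p %| d)%N ->
  exists alpha : module_algebra G A, homogeneous alpha g (t + 1).
Proof.
move=> hp gp /dvdnP [e de]; rewrite -(scale1r 1).
have p_gt0 := prime_gt0 (pcharf_prime hp).
have gen1 : generates (t + 1%:A) := generates_shift 1 gen.
apply: (graded_quotient gen1 (shifted_kernelE 1) (g0 := 1%g)) => i.
have -> : ('X - 1%:P : {poly k}) ^+ d = ('X - 1%:P) ^+ e \Po 'X^p.
  rewrite rmorphXn /= comp_polyB comp_polyX comp_polyC de mulnC exprM.
  have hpP : p \in [pchar {poly k}] by rewrite pchar_poly.
  by rewrite -(expn1 p) subX_pchar // expn1 -rmorphXn expr1n.
rewrite coef_comp_poly_Xn //; case: dvdnP => [[j ->] _|]; last by rewrite eqxx.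
by rewrite mulnC expgnA gp expg1n.
Qed.
End ShiftedGenerator.

Lemma primitive_morph (k : comNzRingType) (G : finGroupType) (x : dualgrp k G) :
  primitive x -> forall g g', x (g * g')%g = x g + x g'.
Proof.
move=> /ffunP prim g g'; have /ffunP/(_ g) := prim g'.
rewrite !ffunE => ->; congr (_ + _); first by rewrite /GRing.scale /= mul1r.
by rewrite /GRing.scale /= mulr1.
Qed.

Lemma primitive1 (k : comNzRingType) (G : finGroupType) (x : dualgrp k G) :
  primitive x -> x 1%g = 0.
Proof.
by move=> /primitive_morph/(_ 1%g 1%g)/eqP; rewrite mulg1 -subr_eq0 opprD addNKr oppr_eq0 => /eqP.
Qed.

(** Both shifted generators have annihilator [(X - c)^d], so an automorphism of [A] carries one to
    the other, and [sigma] matches their degrees. The values [c = 0] and [c = 1] serve the two kinds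
    of grading. *)
Lemma twist_of_generators (k : fieldType) (G : finGroupType) (A : falgType k)
    (alpha beta : module_algebra G A) (s t : A) (m m' : nat) (c : k) (g1 : G)
    (sigma : G -> G) :
    {morph sigma : g g' / (g * g')%g} -> injective sigma ->
    generates s -> s ^+ m = 0 -> homogeneous beta (sigma g1) (s + c%:A) ->
    generates t -> t ^+ m' = 0 -> homogeneous alpha g1 (t + c%:A) ->
  twist_equivalent (smash_product beta) (smash_product alpha).
Proof.
move=> sigmaM sigma_inj gens sm homs gent tm homt.
have [genu genv] := (generates_shift c gens, generates_shift c gent).
have [|phi [phi_bij phiE]] := generator_aut genu genv.
  move=> P; apply: iff_trans (shifted_kernelE gent tm c P).
  exact: iff_sym (shifted_kernelE gens sm c P).
have sigmaX i : sigma (g1 ^+ i)%g = (sigma g1 ^+ i)%g.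
  elim: i => [|i IHi]; last by rewrite !expgS sigmaM IHi.
  by rewrite !expg0; apply: (mulgI (sigma 1%g)); rewrite -sigmaM !mulg1.
apply: (smash_twist sigmaM sigma_inj phi_bij) => g a.
have [P ->] := genu a; rewrite phiE !(act_horner_alg _ _ homs) !(act_horner_alg _ _ homt).
rewrite linear_sum; apply: eq_bigr => i _; rewrite linearZ /= rmorphXn /=.
have /(_ 'X) := phiE; rewrite !horner_algX => ->.
by rewrite !ffunE -sigmaX (inj_eq sigma_inj).
Qed.

(** * Homogeneous generators of an arbitrary grading *)

Section Classification.
Variables (k : fieldType) (G : finGroupType) (A : falgType k).
Variables (beta : module_algebra G A) (x : dualgrp k G) (prim : primitive x).
Hypothesis x_neq0 : forall g : G, g != 1%g -> x g != 0.
Variables (t : A) (m : nat) (gen : generates t) (tm : t ^+ m = 0).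

Lemma act_primitiveX (s : A) (c : k) i :
    beta x s = c *: (s + 1) ->
  beta x (s ^+ i.+1) = (i.+1%:R * c) *: (s ^+ i.+1 + s ^+ i).
Proof.
move=> xs; elim: i => [|i IHi]; first by rewrite mul1r xs expr0 expr1.
rewrite exprS act_primitive // IHi xs -scalerAl -scalerAr mulrDl mul1r mulrDr -!exprS.
by rewrite -scalerDl -[i.+2%:R]natr1 mulrDl mul1r addrC.
Qed.

Lemma act_primitive_shift s g : homogeneous beta g (s + 1) ->
  beta x s = (x g : k) *: (s + 1).
Proof.
move=> hs; have := act_one beta x; rewrite /counit primitive1 // scale0r => x1.
by have := hs x; rewrite linearD /= x1 addr0.
Qed.

(** Applying the derivation [x] to [s^d = 0] gives [d c s^(d-1) = 0], where [s^(d-1)] is nonzero. *)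
Lemma dim_eq0_of_shifted (s : A) ms (c : k) :
    generates s -> s ^+ ms = 0 -> c != 0 -> beta x s = c *: (s + 1) ->
  (\dim {:A})%:R = 0 :> k.
Proof.
move=> gens sm c0 xs.
have ker P := generator_kernel P gens sm.
have dA : (0 < \dim {:A})%N := adim_gt0 _.
have sd : s ^+ \dim {:A} = 0.
  by rewrite -[s in LHS]horner_algX -rmorphXn; apply/ker.
have sd1 : s ^+ (\dim {:A}).-1 != 0.
  rewrite -[s in X in X != 0]horner_algX -rmorphXn /=; apply/eqP => /ker /dvdp_XnP.
  by move/(_ (\dim {:A}).-1); rewrite ltn_predL dA coefXn eqxx => /(_ isT)/eqP; rewrite oner_eq0.
have /eqP := act_primitiveX (\dim {:A}).-1 xs.
rewrite prednK // sd add0r linear0 eq_sym scaler_eq0 (negPf sd1) orbF mulf_eq0.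
by rewrite (negPf c0) orbF => /eqP.
Qed.

(** The components of [t] are polynomials in [t] summing to [t]. If one of nontrivial degree has a
    nonzero constant term, it is rescaled to [s + 1]. Otherwise no component has a constant term,
    and one with a nonzero linear term is the required generator. *)
Lemma classification :
  (exists s ms (g : G), [/\ generates s, s ^+ ms = 0 & homogeneous beta g s]) \/
  (exists s ms (g : G),
     [/\ generates s, s ^+ ms = 0, g != 1%g & homogeneous beta g (s + 1)]).
Proof.
have comm := generates_comm gen.
have ker P := generator_kernel P gen tm.
have dA : (0 < \dim {:A})%N := adim_gt0 _.
have /fin_all_exists [P defP] (g : G) : exists P, beta (delta k g) t = horner_alg t P.
  exact: gen.
have nilP (Q : {poly k}) : Q`_0 = 0 -> horner_alg t Q ^+ m = 0.
  move/coef0_XM => ->; rewrite rmorphM /= horner_algX.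
  by rewrite exprMn_comm ?tm ?mul0r //; apply/esym/comm_horner_alg.
have [[g /andP [g1 Pg0]]|all0] := altP (@existsP _ (fun g => (g != 1%g) && ((P g)`_0 != 0))).
  right; pose Q := ((P g)`_0)^-1 *: P g - 1.
  have Q0 : Q`_0 = 0 by rewrite coefB coefZ coef1 mulVf ?subrr.
  have hom : homogeneous beta g (horner_alg t Q + 1).
    rewrite rmorphB rmorph1 /= subrK horner_algZ -defP.
    exact/homogeneousZ/homogeneous_delta.
  exists (horner_alg t Q), m, g; split=> //; last exact: nilP.
  have [Q1|] := eqVneq Q`_1 0; last exact: generates_linear_coef gen tm Q0.
  pose R := drop_poly 1 Q.
  have defQ : Q = 'X * R by exact: coef0_XM.
  have defR : R = 'X * drop_poly 1 R by apply: coef0_XM; rewrite coef_drop_poly.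
  have xs := act_primitive_shift hom.
  (* Without a linear term, [s = t (t b)]. By the Leibniz rule [x s] is a multiple of [t], but it
     also equals [x g (s + 1)]; this would make the nilpotent [t] a unit. *)
  have [b defb] : exists b, horner_alg t Q = t * (t * b).
    exists (horner_alg t (drop_poly 1 R)); rewrite defQ [in LHS]defR.
    by rewrite !rmorphM /= horner_algX.
  have [T defT] : exists b, 1 = t * b.
    have xg := x_neq0 g1.
    exists ((x g : k)^-1 *: (beta x t * b + beta x (t * b)) - t * b).
    rewrite mulrBr -scalerAr mulrDr mulrA (comm t) -mulrA -(comm b) (comm b).
    rewrite -act_primitive // -defb xs scalerA mulVf // scale1r.
    by rewrite addrAC subrr add0r.
  by case: (nilpotent_mul_neq1 (comm t T) tm).
(* For [d = 1] the generator is [0]; for [d >= 2] the constant and linear coefficients of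
   polynomials in [t] are well defined. *)
left; have [d1|d1] := leqP (\dim {:A}) 1.
  have t0 : t = 0.
    by rewrite -[LHS]horner_algX; apply/ker; rewrite -[X in _ %| X]expr1 dvdp_exp2l.
  by exists t, m, 1%g; split=> // h; rewrite t0 linear0 scaler0.
have t_sum : horner_alg t (\sum_g P g - 'X) = 0.
  rewrite rmorphB rmorph_sum /= horner_algX {2}(sum_act_delta beta t).
  by apply/eqP; rewrite subr_eq0; apply/eqP/eq_bigr.
have sumP : forall i, (i < 2)%N -> \sum_g (P g)`_i = 'X`_i.
  move=> i i2; have /ker/dvdp_XnP/(_ i (leq_trans i2 d1))/eqP := t_sum.
  by rewrite coefB coef_sum subr_eq0 => /eqP.
have P0 g : (P g)`_0 = 0.
  have P0' r : r != 1%g -> (P r)`_0 = 0.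
    by move=> r1; apply: contraNeq all0 => Pr; apply/existsP; exists r; rewrite r1.
  have [->|/P0'//] := eqVneq g 1%g.
  have := sumP 0%N isT; rewrite coefX (bigD1 1%g) //= big1 ?addr0 //.
have [g Pg1] : exists g, (P g)`_1 != 0.
  apply/existsP; rewrite -negb_forall; apply/negP => /forallP P1.
  have := sumP 1%N isT; rewrite coefX big1 => [/esym/eqP|g _]; last exact/eqP/P1.
  by rewrite oner_eq0.
exists (beta (delta k g) t), m, g; rewrite defP; split.
- exact: generates_linear_coef gen tm (P0 g) Pg1.
- exact: nilP.
- by rewrite -defP; exact: homogeneous_delta.
Qed.
End Classification.

(** * Cleft extensions *)

Lemma tensr_id (k : comNzRingType) (G : finGroupType) (M : lmodType k)
    (T : tensor G M) : tensr (idfun : dualgrp k G -> dualgrp k G) T = T.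
Proof. exact/esym/tens_delta. Qed.

Section CleftSplitting.
Variables (k : comNzRingType) (G : finGroupType) (A : algType k).
Variable E : cleft_extension G A.
Local Notation incl := (cleft_incl E).
Local Notation rho := (@cleft_coact k G A E).
Implicit Types (a : A) (b c : E) (g h r s : G).

Lemma coactM b c g : rho (b * c) g = rho b g * rho c g.
Proof. by rewrite (coact_mul (cleft_comodule E)) ffunE. Qed.

Lemma coactP x b c g : rho (x *: b + c) g = x *: rho b g + rho c g.
Proof. by rewrite (coact_linear (cleft_comodule E)) !ffunE. Qed.

Let coactL g : {linear E -> E} :=
  HB.pack (fun b => rho b g)
    (GRing.isLinear.Build k E E *:%R (fun b => rho b g) (fun x b c => coactP x b c g)).

Lemma coact_sum I (r : seq I) (F : I -> E) g :
  rho (\sum_(i <- r) F i) g = \sum_(i <- r) rho (F i) g.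
Proof. exact: (linear_sum (coactL g)). Qed.

Lemma coactZ x b g : rho (x *: b) g = x *: rho b g.
Proof. exact: (linearZ_LR (coactL g)). Qed.

Lemma coact_incl a g : rho (incl a) g = incl a.
Proof.
have -> : rho (incl a) = tens (incl a) 1 by apply/cleft_coinv; exists a.
by rewrite !ffunE scale1r.
Qed.

(** With [coactM] and [coact_1g], this says that [b |-> rho b g] is an action of [G] on [E] by
    algebra maps. *)
Lemma coact_coact b g h : rho (rho b h) g = rho b (g * h)%g.
Proof.
have := coact_coassoc (cleft_comodule E) b; rewrite tenslE tens_comulE.
by move=> /ffunP/(_ h)/ffunP/(_ g); rewrite !ffunE.
Qed.

Lemma coact_1g b : rho b 1%g = b.
Proof.
rewrite -[RHS](coact_counit (cleft_comodule E)) /tfold (bigD1 1%g) //=.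
rewrite counit_delta eqxx scale1r big1 ?addr0 // => g /negPf g1.
by rewrite counit_delta g1 scale0r.
Qed.

Lemma coinvariantP b : (forall g, rho b g = b) -> exists a, incl a == b.
Proof.
move=> inv; have /cleft_coinv [a ->] : rho b = tens b 1; last by exists a.
by apply/ffunP=> g; rewrite inv !ffunE scale1r.
Qed.

Variable e : G -> E.
Hypothesis e_orth : forall g h, e g * e h = (g == h)%:R *: e g.
Hypothesis e_sum : \sum_g e g = 1.
Hypothesis coact_e : forall s g, rho (e s) g = e (s * g^-1)%g.

Fact trace_coinv b : exists a, incl a == \sum_h rho b h.
Proof.
apply: coinvariantP => g; rewrite coact_sum; under eq_bigr do rewrite coact_coact.
by rewrite [RHS](reindex_inj (mulgI g)).
Qed.
Definition cleft_trace b : A := xchoose (trace_coinv b).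

Lemma cleft_traceE b : incl (cleft_trace b) = \sum_h rho b h.
Proof. exact/eqP/(xchooseP (trace_coinv b)). Qed.

(* [gamma(h_1) a gamma(S h_2)] for the algebra map [gamma : delta g |-> e g]. *)
Fact peirce_coinv (x : dualgrp k G) a : exists a',
  incl a' == \sum_g (x g : k) *: \sum_s e (g * s)%g * incl a * e s.
Proof.
apply: coinvariantP => r; rewrite coact_sum; apply: eq_bigr => g _.
rewrite coactZ coact_sum [in RHS](reindex_inj (mulIg r^-1%g)) /=; congr (_ *: _).
by apply: eq_bigr => s _; rewrite !coactM coact_incl !coact_e mulgA.
Qed.
Definition peirce_act (x : dualgrp k G) a : A := xchoose (peirce_coinv x a).

(** The Peirce block [(r, s)] is homogeneous of degree [r s^-1]. Since elements are determined by
    their blocks, the module algebra axioms reduce to this formula. *)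
Lemma peirce_actE (x : dualgrp k G) a r s :
  e r * incl (peirce_act x a) * e s = (x (r * s^-1)%g : k) *: (e r * incl a * e s).
Proof.
rewrite (eqP (xchooseP (peirce_coinv x a))) mulr_sumr mulr_suml.
rewrite (bigD1 (r * s^-1)%g) //= [X in _ + X]big1 ?addr0 => [|g gr].
  rewrite -scalerAr -scalerAl; congr (_ *: _); rewrite mulr_sumr mulr_suml.
  rewrite (bigD1 s) //= [X in _ + X]big1 ?addr0 => [|h /negPf hs].
    by rewrite mulgKV !mulrA e_orth eqxx scale1r -!mulrA e_orth eqxx scale1r.
  by rewrite -!mulrA e_orth hs scale0r !mulr0.
rewrite -scalerAr -scalerAl mulr_sumr mulr_suml big1 ?scaler0 // => h _.
have [->|/negPf hs] := eqVneq h s; last by rewrite -!mulrA e_orth hs scale0r !mulr0.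
rewrite !mulrA e_orth (_ : r == _ = false) ?scale0r ?mul0r //.
by apply: contraNF gr => /eqP ->; rewrite mulgK.
Qed.

Lemma peirce_ext b c : (forall r s, e r * b * e s = e r * c * e s) -> b = c.
Proof.
have decomp b' : b' = \sum_r \sum_s e r * b' * e s.
  under eq_bigr do rewrite -mulr_sumr e_sum mulr1.
  by rewrite -mulr_suml e_sum mul1r.
by move=> bc; rewrite (decomp b) (decomp c); apply: eq_bigr => r _; apply: eq_bigr.
Qed.

Let ext a a' : (forall r s, e r * incl a * e s = e r * incl a' * e s) -> a = a'.
Proof. by move/peirce_ext/cleft_incl_inj. Qed.

Fact peirce_act_linearl a : linear (peirce_act^~ a).
Proof.
move=> c x y; apply: ext => r s; rewrite peirce_actE linearP /= mulrDr mulrDl.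
rewrite -scalerAr -scalerAl !peirce_actE !ffunE.
by rewrite scalerA -scalerDl.
Qed.

Fact peirce_act_linearr x : linear (peirce_act x).
Proof.
move=> c a a'; apply: ext => r s; rewrite peirce_actE !linearP /= !mulrDr !mulrDl.
by rewrite -!scalerAr -!scalerAl !peirce_actE scalerDr !scalerA mulrC.
Qed.

Fact peirce_act_1 a : peirce_act 1 a = a.
Proof. by apply: ext => r s; rewrite peirce_actE ffunE scale1r. Qed.

Fact peirce_act_M x y a : peirce_act (x * y) a = peirce_act x (peirce_act y a).
Proof. by apply: ext => r s; rewrite !peirce_actE ffunE scalerA. Qed.

Fact peirce_act_mul x a a' : peirce_act x (a * a') =
  tfold (fun x1 x2 => peirce_act x1 a * peirce_act x2 a') (comul x).
Proof.
apply: ext => r s; rewrite peirce_actE.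
(* Inserting [1 = \sum e w] composes blocks, and degrees multiply: [(r w^-1) (w s^-1) = r s^-1]. *)
have split b c : e r * (b * c) * e s = \sum_w e r * b * e w * (e w * c * e s).
  rewrite -[b in LHS]mulr1 -e_sum mulr_sumr mulr_suml mulr_sumr mulr_suml.
  by apply: eq_bigr => w _; rewrite !mulrA -(mulrA _ (e w) (e w)) e_orth eqxx scale1r.
rewrite rmorphM split rmorph_sum mulr_sumr mulr_suml scaler_sumr.
under [RHS]eq_bigr do rewrite rmorphM split.
rewrite exchange_big /=; apply: eq_bigr => w _.
rewrite (bigD1 (w * s^-1)%g) //= big1 ?addr0 => [|g /negPf gw].
  rewrite !peirce_actE comulE deltaE eqxx scale1r -scalerAl.
  by rewrite mulgA mulgKV.
by rewrite !peirce_actE deltaE gw scale0r mulr0.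
Qed.

Fact peirce_act_one x : peirce_act x 1 = (counit x)%:A.
Proof.
apply: ext => r s; rewrite peirce_actE linearZ /= rmorph1 mulr1 -scalerAr mulr1 -scalerAl.
rewrite e_orth; case: eqP => [->|_]; first by rewrite mulgV.
by rewrite scale0r !scaler0.
Qed.

Definition peirce_action : module_algebra G A :=
  ModuleAlgebra peirce_act_linearl peirce_act_linearr peirce_act_1
    peirce_act_M peirce_act_mul peirce_act_one.
Local Notation smash := (smash_product peirce_action).

Lemma peirce_act_delta g a s :
  incl (peirce_act (delta k g) a) * e s = e (g * s)%g * incl a * e s.
Proof.
rewrite -[LHS]mul1r -e_sum mulr_suml (bigD1 (g * s)%g) //= big1 ?addr0 => [|r rg].
  by rewrite mulrA peirce_actE deltaE mulgK eqxx scale1r.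
rewrite mulrA peirce_actE deltaE (_ : g == _ = false) ?scale0r //.
by apply: contraNF rg => /eqP ->; rewrite mulgKV.
Qed.

(** The coordinates of [b] in the [A]-basis [e], computed by traces; [split_inv] recombines them. *)
Definition split_map b : smash := [ffun g => cleft_trace (b * e g)] : tensor G A.
Definition split_inv (u : smash) : E := \sum_g incl ((u : tensor G A) g) * e g.

(** In [tr(b e_g) e_g] the translate by [h] contains [e_(g h^-1) e_g], so only [h = 1] survives,
    contributing [b e_g]. *)
Lemma split_mapK : cancel split_map split_inv.
Proof.
move=> b; rewrite /split_inv -[RHS]mulr1 -e_sum mulr_sumr; apply: eq_bigr => g _.
rewrite ffunE cleft_traceE mulr_suml (bigD1 1%g) //= big1 ?addr0 => [|h h1].
  by rewrite coact_1g -mulrA e_orth eqxx scale1r.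
rewrite coactM coact_e -mulrA e_orth (_ : _ == g = false) ?scale0r ?mulr0 //.
by apply: contraNF h1; rewrite -[g in X in _ == X]mulg1 (inj_eq (mulgI g)) eq_invg1.
Qed.

Lemma split_invK : cancel split_inv split_map.
Proof.
move=> u; apply/ffunP=> g; apply: (@cleft_incl_inj _ _ _ E); rewrite ffunE cleft_traceE.
have -> : split_inv u * e g = incl ((u : tensor G A) g) * e g.
  rewrite /split_inv mulr_suml (bigD1 g) //= big1 => [|h /negPf hg].
    by rewrite addr0 -mulrA e_orth eqxx scale1r.
  by rewrite -mulrA e_orth hg scale0r mulr0.
under eq_bigr do rewrite coactM coact_incl coact_e.
rewrite -mulr_sumr (reindex_inj (mulIg g)) (reindex_inj invg_inj) /=.
under eq_bigr do rewrite invMg invgK mulKVg.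
by rewrite e_sum mulr1.
Qed.

Lemma split_invM u v : split_inv (u * v) = split_inv u * split_inv v.
Proof.
rewrite /split_inv mulr_sumr; apply: eq_bigr => s _.
rewrite smash_mulrE rmorph_sum !mulr_suml; apply: eq_bigr => g _.
by rewrite rmorphM -mulrA peirce_act_delta mulgKV !mulrA.
Qed.

Lemma split_inv_linear : linear split_inv.
Proof.
move=> c u v; rewrite /split_inv scaler_sumr -big_split; apply: eq_bigr => g _.
by rewrite !ffunE linearP mulrDl -scalerAl.
Qed.

Fact split_map_linear : linear split_map.
Proof.
move=> c b b'; rewrite -{1}(split_mapK b) -{1}(split_mapK b') -split_inv_linear.
exact: split_invK.
Qed.
HB.instance Definition _ :=
  GRing.isLinear.Build k E smash *:%R split_map split_map_linear.

Fact split_map_monoid : monoid_morphism split_map.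
Proof.
split=> [|b c].
  apply: (can_inj split_invK); rewrite split_mapK /split_inv -[LHS]e_sum.
  by apply: eq_bigr => g _; rewrite !ffunE scale1r rmorph1 mul1r.
by rewrite -{1}(split_mapK b) -{1}(split_mapK c) -split_invM split_invK.
Qed.
HB.instance Definition _ :=
  GRing.isMonoidMorphism.Build E smash split_map split_map_monoid.

Lemma cleft_twist_smash : twist_equivalent E smash.
Proof.
exists idfun, idfun, split_map; split.
- by exists id.
- split=> //; first by exists id.
  by move=> x; rewrite tensr_id tenslE; apply/ffunP=> g; rewrite [RHS]ffunE.
- by exists split_inv; [exact: split_mapK | exact: split_invK].
- move=> a b; rewrite rmorphM; congr (_ * _); apply: (can_inj split_invK).
  rewrite split_mapK /split_inv -[LHS]mulr1 -e_sum mulr_sumr; apply: eq_bigr => g _.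
  by rewrite cleft_inclE ffunE.
move=> b; rewrite tensr_id tenslE.
apply/ffunP=> g'; apply/ffunP=> g; rewrite smash_coactE !ffunE.
apply: (@cleft_incl_inj _ _ _ E); rewrite !cleft_traceE [RHS](reindex_inj (mulIg g')) /=.
apply: eq_bigr => h _; rewrite !coactM !coact_coact !coact_e.
by rewrite invMg mulgA mulgK.
Qed.
End CleftSplitting.

(** [gamma 1] is a coinvariant unit with inverse [gamma' 1], and [g] moves [gamma x] to
    [gamma x + x g * gamma 1]; dividing by [gamma 1] gives [X]. *)
Lemma cleft_translate (k : comNzRingType) (G : finGroupType) (x : dualgrp k G)
    (A : algType k) (E : cleft_extension G A) : primitive x ->
  exists X : E, forall g, cleft_coact X g = X + (x g : k)%:A.
Proof.
move=> prim.
have [gamma [[lin_gamma colin] [gamma' [lin_gamma' inv inv']]]] := cleft_cleaving E.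
have comul1 : comul (1 : dualgrp k G) = tens 1 1.
  by apply/ffunP=> g'; apply/ffunP=> g; rewrite comulE !ffunE scale1r.
have bilinear (f f' : dualgrp k G -> E) : linear f -> linear f' ->
    convolution f f' 1 = f 1 * f' 1.
  move=> linf linf'; rewrite /convolution comul1 tfold_tens // => [l|m] c u v.
    by rewrite linf mulrDl -scalerAl.
  by rewrite linf' mulrDr -scalerAr.
have counit1 : (counit (1 : dualgrp k G))%:A = 1 :> E by rewrite /counit ffunE scale1r.
have w1 : gamma 1 * gamma' 1 = 1 by rewrite -bilinear // inv counit1.
have w2 : gamma' 1 * gamma 1 = 1 by rewrite -bilinear // inv' counit1.
have coact_gamma h g : cleft_coact (gamma h) g = gamma (comul h g).
  by rewrite colin tenslE ffunE.
have coact_w g : cleft_coact (gamma' 1) g = gamma' 1.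
  have g1 : cleft_coact (gamma 1) g = gamma 1.
    by rewrite coact_gamma; congr gamma; apply/ffunP=> s; rewrite comulE !ffunE.
  rewrite -[LHS]mul1r -w2 -mulrA -{1}g1 -coactM w1 (coact_one (cleft_comodule E)).
  by rewrite ffunE mulr1.
have comul_x g : comul x g = (x g : k) *: 1 + x.
  by rewrite prim !ffunE scale1r addrC.
exists (gamma' 1 * gamma x) => g; rewrite coactM coact_w coact_gamma comul_x.
by rewrite lin_gamma mulrDr -scalerAr w2 addrC.
Qed.

(** * Splitting a cleft extension by a character onto [F_q] *)

Section PrimitiveGenerator.
Variables (k : closedFieldType) (p n : nat) (hp : p \in [pchar k]) (hn : (0 < n)%N).
Local Notation q := (p ^ n)%N.
Variables (G : finGroupType) (chi : G -> k).
Hypotheses (chiM : forall g h, chi (g * h)%g = chi g + chi h).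
Hypotheses (chi_inj : injective chi) (chi_fixed : forall g, chi g ^+ q = chi g).
Hypothesis card_G : #|G| = q.
Local Notation xs := [seq chi g | g : G].

(** The [q] distinct values of [chi] are roots of [X^q - X], hence all of its roots. *)
Lemma vanishing_dvdp (P : {poly k}) : (forall g, P.[chi g] = 0) -> 'X^q - 'X %| P.
Proof.
have dvd_xs R : (forall g, R.[chi g] = 0) -> \prod_(z <- xs) ('X - z%:P) %| R.
  move=> R0; apply: uniq_roots_dvdp.
    by apply/allP => z /mapP [g _ ->]; rewrite rootE R0.
  by rewrite uniq_rootsE map_inj_uniq ?enum_uniq.
suff -> : 'X^q - 'X = \prod_(z <- xs) ('X - z%:P) by exact: dvd_xs.
apply/eqP; rewrite eq_sym -eqp_monic ?monic_prod_XsubC ?(monic_XqsubX hp hn) //.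
have dvdX : \prod_(z <- xs) ('X - z%:P) %| 'X^q - 'X.
  by apply: dvd_xs => g; rewrite !hornerE chi_fixed subrr.
by rewrite -(dvdp_size_eqp dvdX) size_prod_XsubC size_image card_G (size_XqsubX hp hn).
Qed.

Lemma fixed_in_image (z : k) : z ^+ q = z -> exists g, chi g = z.
Proof.
move=> zq; have /(_ (\prod_(z <- xs) ('X - z%:P))) := @vanishing_dvdp.
have root_xs g : (\prod_(z <- xs) ('X - z%:P)).[chi g] = 0.
  by apply/eqP; rewrite -rootE root_prod_XsubC map_f ?mem_enum.
move=> /(_ root_xs)/dvdpP [Q defP].
have : root (\prod_(z <- xs) ('X - z%:P)) z.
  by rewrite defP rootE !hornerE zq subrr mulr0.
by rewrite root_prod_XsubC => /mapP [g _ ->]; exists g.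
Qed.

Lemma interpolation_inj (h : G -> k) : exists L : {poly k}, forall s, L.[chi s] = h s.
Proof.
have [|L hL] := @interpolation k xs (fun z y => forall s, chi s = z -> y = h s).
  move=> z; have [[s /eqP <-]|no] := altP (@existsP _ (fun s => chi s == z)).
    by exists (h s) => s' /chi_inj ->.
  by exists 0 => s xs_z; case/existsP: no; exists s; rewrite xs_z.
by exists L => s; apply: hL => //; rewrite map_f ?mem_enum.
Qed.

Section Idempotents.
Variables (A : falgType k) (E : cleft_extension G A).
Hypothesis translate : exists X : E, forall g, cleft_coact X g = X + (chi g)%:A.
Local Notation incl := (cleft_incl E).
Local Notation rho := (@cleft_coact k G A E).

Lemma cleft_fixed_translate :
  exists2 y : E, y ^+ q = y & forall g, rho y g = y + (chi g)%:A.
Proof.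
have [X coactX] := translate.
have hpE : p \in [pchar E] by rewrite pchar_lalg.
have coactXn b m g : rho (b ^+ m) g = rho b g ^+ m.
  elim: m => [|m IHm]; last by rewrite !exprS coactM IHm.
  by rewrite expr0 (coact_one (cleft_comodule E)) ffunE.
(* The translation by [chi g] cancels because [chi g ^+ q = chi g]. *)
have [a /eqP defa] : exists a, incl a == X ^+ q - X.
  apply: coinvariantP => g; rewrite -scaleN1r addrC coactP coactXn coactX.
  rewrite exprDn_comm_pchar ?mulr_algr ?mulr_algl //.
  rewrite exprZn expr1n chi_fixed !scaleN1r opprD addrACA addNr.
  by rewrite addr0.
have [C defC] := artin_schreier hp hn a.
have aX : incl a * X = X * incl a by rewrite defa mulrBl mulrBr -exprS -exprSr.
have cX : X * incl (horner_alg a C) = incl (horner_alg a C) * X.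
  by rewrite rmorph_horner_alg; apply/esym/comm_horner_alg.
exists (X + incl (horner_alg a C)).
  rewrite exprDn_comm_pchar // -rmorphXn -rmorphXn /=.
  have -> : X ^+ q = X + incl a by rewrite defa addrC subrK.
  rewrite -addrA -rmorphD; congr (_ + incl _).
  apply/eqP; have /eqP := defC; rewrite rmorphD rmorphB /= horner_algX.
  by rewrite -[a + _ == _]subr_eq0 [a + _]addrC addrAC.
move=> g; rewrite -[X in rho (X + _)]scale1r coactP scale1r coactX coact_incl.
by rewrite addrAC.
Qed.

(** As [y^q = y], a polynomial at [y] depends only on its values on [chi G], so functions on [G] can
    be evaluated at [y]. The idempotents are the images of the [delta g], and moving [y] to
    [y + chi g] translates these functions. *)
Lemma cleft_is_smash : exists alpha : module_algebra G A,
  twist_equivalent E (smash_product alpha).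
Proof.
have [y yq coact_y] := cleft_fixed_translate.
have /fin_all_exists [L hL] (g : G) : exists L : {poly k}, forall s, L.[chi s] = (g == s)%:R.
  exact: interpolation_inj.
have vanish P P' : (forall g, P.[chi g] = P'.[chi g]) -> horner_alg y P = horner_alg y P'.
  move=> PP; apply/eqP; rewrite -subr_eq0 -rmorphB.
  have /dvdpP [Q ->] : 'X^q - 'X %| P - P'.
    by apply: vanishing_dvdp => g; rewrite !hornerE PP subrr.
  by rewrite rmorphM rmorphB rmorphXn /= horner_algX yq subrr mulr0.
pose e g := horner_alg y (L g).
have coact_horner g P : rho (horner_alg y P) g = horner_alg (rho y g) P.
  elim/poly_ind: P => [|P c IHP].
    by rewrite !rmorph0 -(scale0r 0) coactZ !scale0r.
  rewrite !(rmorphD, rmorphM) /= !horner_algX !horner_algC addrC coactP coactM IHP.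
  by rewrite (coact_one (cleft_comodule E)) ffunE addrC.
suff [e_orth e_sum coact_e] : [/\ forall g h, e g * e h = (g == h)%:R *: e g,
    \sum_g e g = 1 & forall s g, rho (e s) g = e (s * g^-1)%g].
  by exists (peirce_action e_orth e_sum coact_e); exact: cleft_twist_smash.
split=> [g h||s g].
- rewrite -rmorphM -horner_algZ; apply: vanish => s; rewrite !hornerE !hL.
  by case: (g =P s) => [->|_]; rewrite ?mul1r ?mulr1 ?mul0r ?mulr0 // eq_sym.
- rewrite -rmorph_sum -(rmorph1 (horner_alg y)); apply: vanish => s.
  rewrite horner_sum hornerC (bigD1 s) //= big1 ?addr0 ?hL ?eqxx // => g /negPf gs.
  by rewrite hL gs.
have -> : rho (e s) g = horner_alg y (L s \Po ('X + (chi g)%:P)).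
  by rewrite coact_horner coact_y horner_alg_comp rmorphD /= horner_algX horner_algC.
apply: vanish => h.
by rewrite horner_comp !hornerE -chiM !hL -(inj_eq (mulIg g) (s * g^-1)%g) mulgKV.
Qed.
End Idempotents.
End PrimitiveGenerator.

(** * Elementary abelian groups *)

Section DualGroupAlgebra.
Variables (k : comNzRingType) (G : finGroupType).
Implicit Types (x h : dualgrp k G) (g : G).

Lemma dual_expE x i g : (x ^+ i) g = (x g : k) ^+ i.
Proof. by elim: i => [|i IHi]; rewrite ?expr0 ?exprS ffunE ?IHi. Qed.

Lemma dual_horner_alg x P g : horner_alg x P g = P.[x g : k].
Proof.
elim/poly_ind: P => [|P c IHP]; first by rewrite rmorph0 ffunE horner0.
rewrite rmorphD rmorphM /= horner_algX horner_algC !ffunE IHP !hornerE.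
by rewrite /GRing.scale /= mulr1.
Qed.

Lemma generates_inj x : generates x -> injective (x : G -> k).
Proof.
move=> gen g g' xg; have [P dP] := gen (delta k g).
have : delta k g g = delta k g g' by rewrite dP !dual_horner_alg xg.
by rewrite !deltaE eqxx; case: eqP => // _ /eqP; rewrite oner_eq0.
Qed.

Lemma morph_primitive x : (forall g g', x (g * g')%g = x g + x g') -> primitive x.
Proof.
move=> xM; apply/ffunP=> g'; apply/ffunP=> g.
by rewrite comulE xM !ffunE /GRing.scale /= mul1r mulr1.
Qed.
End DualGroupAlgebra.

Section ElementaryAbelian.
Variables (k : closedFieldType) (p n : nat) (hp : p \in [pchar k]) (hn : (0 < n)%N).
Local Notation q := (p ^ n)%N.
Local Notation G := (Cpn p n).

Let p_gt1 : (1 < p)%N := prime_gt1 (pcharf_prime hp).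

Lemma card_Cpn : #|G| = q.
Proof. by rewrite card_mx card_ord Zp_cast // mul1n. Qed.

Lemma Cpn_generator : exists x : dualgrp k G,
  [/\ primitive x, generates x & x ^+ q = x].
Proof.
have [w [wfix indep]] := independent_fixed hp hn (leqnn n).
(* The coordinates of [v] are used against a basis of [F_q] over [F_p], so [chi] identifies [G] with
   [F_q]. *)
pose chi (v : G) : k := \sum_(j < n) ((v : 'rV['Z_p]_n) 0 j : nat)%:R * w j.
have chiM u v : chi (u * v)%g = chi u + chi v.
  rewrite /chi -big_split; apply: eq_bigr => j _ /=; rewrite -mulrDl mxE /=.
  have hpZ : (Zp_trunc p).+2 \in [pchar k] by rewrite Zp_cast.
  by rewrite (GRing.natr_mod_pchar hpZ) natrD.
have chi0 v : chi v = 0 -> v = 1%g.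
  (* Coordinates extended by [0] beyond [n], since [independent_fixed] takes coefficients indexed by
     all naturals. *)
  pose c j := if insub j is Some i then ((v : 'rV['Z_p]_n) 0 i : nat) else 0%N.
  have cE (i : 'I_n) : c i = (v : 'rV['Z_p]_n) 0 i.
    by rewrite /c insubT // => ?; congr (nat_of_ord (_ 0 _)); apply: val_inj.
  move=> v0; apply/rowP => i; rewrite mxE; apply: val_inj => /=.
  have : (p %| c i)%N.
    by apply: indep => //; rewrite -[RHS]v0; apply: eq_bigr => j _; rewrite cE.
  rewrite cE; apply: contraTeq; rewrite -lt0n => vi; rewrite gtnNdvd //.
  by have := ltn_ord ((v : 'rV['Z_p]_n) 0 i); rewrite [X in (_ < X)%N]Zp_cast.
have chi_inj : injective chi.
  move=> u v uv; apply/eqP; rewrite eq_mulgV1; apply/eqP/chi0.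
  by apply: (addIr (chi v)); rewrite -chiM mulgKV add0r.
have chi_fixed v : chi v ^+ q = chi v.
  rewrite /chi; elim: (index_enum _) => [|j s IHs].
    by rewrite big_nil expr0n eqn0Ngt (ltnW (pchar_expn_gt1 hp hn)).
  by rewrite !big_cons exprDn_comm_pchar 1?mulrC // exprMn IHs natr_fixed // wfix.
exists (finfun chi : tensor G k^o); split.
- by apply: morph_primitive => g g'; rewrite !ffunE.
- move=> h; have [L hL] := interpolation_inj chi_inj (h : G -> k).
  by exists L; apply/ffunP=> g; rewrite dual_horner_alg ffunE hL.
- by apply/ffunP=> g; rewrite dual_expE ffunE.
Qed.

Variables (x : dualgrp k G) (prim : primitive x) (gen_x : generates x).
Hypothesis xq : x ^+ q = x.

Let xM := primitive_morph prim.
Let x_inj : injective (x : G -> k) := generates_inj gen_x.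

Let x_fixed (g : G) : (x g : k) ^+ q = x g.
Proof. by rewrite -dual_expE xq. Qed.

Lemma cleft_Cpn (A : falgType k) (E : cleft_extension G A) :
  exists alpha : module_algebra G A, twist_equivalent E (smash_product alpha).
Proof.
exact: (cleft_is_smash hp hn xM x_inj x_fixed card_Cpn (cleft_translate E prim)).
Qed.

Lemma primitive_neq0 (g : G) : g != 1%g -> (x g : k) != 0.
Proof. by apply: contra_neq => xg; apply: x_inj; rewrite xg primitive1. Qed.

Lemma Cpn_expp (g : G) : (g ^+ p)%g = 1%g.
Proof.
have xX i : x (g ^+ i)%g = i%:R * x g :> k.
  elim: i => [|i IHi]; first by rewrite mul0r primitive1.
  by rewrite expgS xM IHi -[in RHS]nat1r mulrDl mul1r.
by apply: x_inj; rewrite xX (pcharf0 hp) mul0r primitive1.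
Qed.

(* [sigma] corresponds under [x] to multiplication by the scalar [x g]. *)
Lemma Cpn_aut (g1 g : G) : x g1 = 1 :> k -> g != 1%g -> exists sigma : G -> G,
  [/\ {morph sigma : h h' / (h * h')%g}, injective sigma & sigma g1 = g].
Proof.
move=> xg1 /primitive_neq0 xg.
have /fin_all_exists [sigma xs] (h : G) : exists h', x h' = x g * x h :> k.
  by apply: (fixed_in_image hp hn x_inj x_fixed card_Cpn); rewrite exprMn !x_fixed.
exists sigma; split=> [h h'|h h' hh'|].
- by apply: x_inj; rewrite xM !xs xM mulrDr.
- by apply: x_inj; apply: (mulfI xg); rewrite -!xs hh'.
- by apply: x_inj; rewrite xs xg1 mulr1.
Qed.

Lemma Cpn_unit_value : exists g1 : G, x g1 = 1 :> k.
Proof. by apply: (fixed_in_image hp hn x_inj x_fixed card_Cpn); rewrite expr1n. Qed.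
End ElementaryAbelian.

(** * Invariants separating the smash products *)

Section Inequivalence.
Variables (k : fieldType) (G : finGroupType) (A : falgType k).
Variables (t : A) (m : nat) (gen : generates t) (tm : t ^+ m = 0).
Variables alpha beta : module_algebra G A.
Hypothesis twist : twist_equivalent (smash_product alpha) (smash_product beta).

Lemma homogeneous1_trivial :
  homogeneous alpha 1%g t -> forall h a, alpha h a = (h 1%g : k) *: a.
Proof.
move=> ht h a; have [P ->] := gen a; rewrite (act_horner_alg _ _ ht) horner_alg_coef.
by rewrite scaler_sumr; apply: eq_bigr => i _; rewrite expg1n scalerA.
Qed.

Lemma twist_trivial : homogeneous alpha 1%g t ->
  forall h a, beta h a = (h 1%g : k) *: a.
Proof.
move/homogeneous1_trivial => triv; apply: commutative_smash_trivial => u v.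
have [phi [psi [f [_ _ [f' _ fK] _ _]]]] := twist.
rewrite -(fK u) -(fK v) -!rmorphM; congr (f _).
exact: trivial_smash_commutative (generates_comm gen) triv _ _.
Qed.

(* A homogeneous [t] is normal in the smash product ([B t = t B]), and twist *)
(* equivalences preserve this because they permute the generators of the nilradical. *)
Lemma twist_stable_ideal g1 g : homogeneous alpha g1 t ->
  exists c, beta (delta k g) t = t * c.
Proof.
move=> ht; have comm := generates_comm gen.
have normal (u : smash_product alpha) : exists b, u * cleft_incl _ t = cleft_incl _ t * b.
  (* Moving [t], of degree [g1], to the left of [u] translates the argument of [u] by [g1]. *)
  exists ([ffun s => (u : tensor G A) (g1 * s)%g] : tensor G A).
  apply/ffunP=> s; rewrite smash_mul_incl smash_incl_mul ffunE (bigD1 (g1 * s)%g) //=.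
  rewrite ht deltaE mulgK eqxx scale1r big1 ?addr0 // => r rg.
  rewrite ht deltaE (_ : _ == g1 = false) ?scale0r ?mulr0 //.
  by apply: contraNF rg => /eqP <-; rewrite mulgKV.
have [phi [psi [f [[phi' phiK phi'K] _ [f' _ fK] fM _]]]] := twist.
have f_incl a : f (cleft_incl _ a) = cleft_incl _ (phi a).
  by rewrite -[cleft_incl _ a]mulr1 fM rmorph1 mulr1.
have phiX a i : a ^+ i = 0 -> phi a ^+ i = 0 by move=> a0; rewrite -rmorphXn a0 rmorph0.
have [a' defs'] : exists a', phi' t = t * a'.
  apply: (nilpotent_multiple (m' := m) gen tm); apply: (can_inj phiK).
  by rewrite rmorphXn /= phi'K tm rmorph0.
have deft : t = phi t * phi a' by rewrite -[LHS]phi'K defs' rmorphM.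
have [a defs] : exists a, phi t = t * a.
  exact: nilpotent_multiple gen tm (phiX _ _ tm).
(* Transported by [f], normality puts [(1 # delta g) t] into [t B]; its value at the identity of [G]
   is the component of [t] of degree [g] under [beta]. *)
have [b] := normal (f' (column beta g)).
move=> /(congr1 f); rewrite !rmorphM /= fK f_incl => eq_b.
exists (a * ((f b * cleft_incl _ (phi a') : smash_product beta) : tensor G A) 1%g).
have := column_mul_incl beta g t 1%g; rewrite invg1 mulg1 => <-.
rewrite {1}deft rmorphM mulrA eq_b -mulrA smash_incl_mul.
by rewrite defs mulrA.
Qed.
End Inequivalence.

Theorem proposition6p6 (k : closedFieldType) (p n : nat)
    (hp : p \in [pchar k]) (hn : (0 < n)%N)
    (A : falgType k) (hcomm : forall a b : A, a * b = b * a)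
    (hlocal : local_algebra A) :
  (forall E : cleft_extension (Cpn p n) A,
     exists alpha : module_algebra (Cpn p n) A,
       twist_equivalent E (smash_product alpha))
  /\ (exists x : dualgrp k (Cpn p n),
        [/\ primitive x, generates x & x ^+ (p ^ n) = x])
  /\ (forall (x : dualgrp k (Cpn p n)) (t : A),
        primitive x -> generates x -> x ^+ (p ^ n) = x ->
        generates t -> (exists m : nat, t ^+ m = 0) ->
      exists alpha0 alpha1 : module_algebra (Cpn p n) A,
      [/\ alpha0 x t = 0,
          alpha1 x t = t,
          (p %| \dim {:A})%N ->
            exists alpha2 : module_algebra (Cpn p n) A,
            [/\ alpha2 x t = t + 1,
                ~ twist_equivalent (smash_product alpha0) (smash_product alpha1),
                ~ twist_equivalent (smash_product alpha0) (smash_product alpha2),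
                ~ twist_equivalent (smash_product alpha1) (smash_product alpha2)
              & forall beta : module_algebra (Cpn p n) A,
                [\/ twist_equivalent (smash_product beta) (smash_product alpha0),
                    twist_equivalent (smash_product beta) (smash_product alpha1)
                  | twist_equivalent (smash_product beta) (smash_product alpha2)]]
        & ~~ (p %| \dim {:A})%N ->
            [/\ forall beta : module_algebra (Cpn p n) A, beta x t <> t + 1,
                t <> 0 ->
                ~ twist_equivalent (smash_product alpha0) (smash_product alpha1)
              & forall beta : module_algebra (Cpn p n) A,
                twist_equivalent (smash_product beta) (smash_product alpha0) \/
                twist_equivalent (smash_product beta) (smash_product alpha1)]]).
Proof.
split; [|split].
- have [x [prim gen xq]] := Cpn_generator hp hn.
  move=> E; exact: (cleft_Cpn hp hn prim gen xq).
- exact: Cpn_generator.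
move=> x t prim gen_x xq gen [m tm].
(* In the degree [g1] where [x] takes the value [1], homogeneity of [t] or of [t + 1] yields
   [x . t = t] or [x . t = t + 1]. *)
have [g1 xg1] := Cpn_unit_value hp hn gen_x xq.
have g1_neq1 : g1 != 1%g.
  by apply/eqP => g11; have /eqP := xg1; rewrite g11 primitive1 // eq_sym oner_eq0.
have dimE : (p %| \dim {:A})%N = ((\dim {:A})%:R == 0 :> k) by rewrite (dvdn_pcharf hp).
have [alpha0 h0] := graded_generator gen tm (1%g : Cpn p n).
have [alpha1 h1] := graded_generator gen tm g1.
have alpha1x : alpha1 x t = t by rewrite h1 xg1 scale1r.
have act_x1 (beta : module_algebra (Cpn p n) A) : beta x 1 = 0.
  by rewrite act_one /counit primitive1 // scale0r.
have addr1_neq0 : t + 1 <> 0.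
  move=> t1; apply: (nilpotent_mul_neq1 (t := t) (b := -1) _ tm); first exact: hcomm.
  by apply/eqP; rewrite mulrN1 -subr_eq0 -opprD t1 oppr0.
have not01 : t <> 0 -> ~ twist_equivalent (smash_product alpha0) (smash_product alpha1).
  move=> t0 /(twist_trivial gen)/(_ h0 x t).
  by rewrite alpha1x primitive1 // scale0r.
have equiv (beta alpha : module_algebra (Cpn p n) A) s ms c g :
    generates s -> s ^+ ms = 0 -> g != 1%g -> homogeneous beta g (s + c%:A) ->
    homogeneous alpha g1 (t + c%:A) ->
    twist_equivalent (smash_product beta) (smash_product alpha).
  move=> gens sm g_neq1 hs ht.
  have [sigma [sigmaM sigma_inj sigma_g1]] := Cpn_aut hp hn prim gen_x xq xg1 g_neq1.
  by apply: (twist_of_generators sigmaM sigma_inj gens sm _ gen tm ht); rewrite sigma_g1.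
have linear_case (beta : module_algebra (Cpn p n) A) s ms g :
    generates s -> s ^+ ms = 0 -> homogeneous beta g s ->
  twist_equivalent (smash_product beta) (smash_product alpha0) \/
  twist_equivalent (smash_product beta) (smash_product alpha1).
  move=> gens sm hs; have addr0A (a : A) : a + 0%:A = a by rewrite scale0r addr0.
  have [g1E|g_neq1] := eqVneq g 1%g; [left | right].
    have id_inj : injective (fun g : Cpn p n => g) by [].
    apply: (@twist_of_generators _ _ _ _ _ s t ms m 0 1%g id _ id_inj) => //.
      by rewrite addr0A -g1E.
    by rewrite addr0A.
  by apply: (equiv _ _ s ms 0 g) => //; rewrite addr0A.
have classify (beta : module_algebra (Cpn p n) A) :=
  classification beta prim (primitive_neq0 prim gen_x) gen tm.
exists alpha0, alpha1; split=> // [|pd|pd].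
- by rewrite h0 primitive1 // scale0r.
- have [alpha2 h2] := graded_shifted_generator gen tm hp (Cpn_expp hp prim gen_x g1) pd.
  have alpha2x : alpha2 x t = t + 1.
    by have := h2 x; rewrite linearD /= act_x1 addr0 xg1 scale1r.
  have d_gt1 : (1 < \dim {:A})%N.
    exact: leq_trans (prime_gt1 (pcharf_prime hp)) (dvdn_leq (adim_gt0 _) pd).
  have t0 : t <> 0.
    move=> t0; have [_] := generator_kernel 'X gen tm.
    rewrite horner_algX => /(_ t0)/dvdp_XnP/(_ 1%N d_gt1)/eqP.
    by rewrite coefX oner_eq0.
  exists alpha2; split=> //.
  - exact: not01.
  - move=> /(twist_trivial gen)/(_ h0 x t).
    by rewrite alpha2x primitive1 // scale0r => /addr1_neq0.
  (* An equivalence would force the component of [t] of degree [g1] under [alpha2] into [t A]; this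
     component is the unit [t + 1]. *)
  - move=> /(twist_stable_ideal gen tm)/(_ g1 g1 h1) [c].
    have -> : alpha2 (delta k g1) t = t + 1.
      have := h2 (delta k g1); rewrite linearD /= act_one counit_delta (negPf g1_neq1).
      by rewrite deltaE eqxx scale0r addr0 scale1r.
    move=> tc; apply: (nilpotent_mul_neq1 (hcomm t (c - 1)) tm).
    by rewrite mulrBr mulr1 -tc addrAC subrr add0r.
  - move=> beta.
    have [[s [ms [g [gens sm hs]]]]|[s [ms [g [gens sm g_neq1 hs]]]]] := classify beta.
      by have [?|?] := linear_case _ _ _ _ gens sm hs; [constructor 1 | constructor 2].
    by constructor 3; apply: (equiv _ _ s ms 1 g) => //; rewrite scale1r.
(* When [p] does not divide [dim A], the shifted case of [classification] contradicts
   [dim_eq0_of_shifted]. *)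
have no_shift (beta : module_algebra (Cpn p n) A) s ms c :
    generates s -> s ^+ ms = 0 -> c != 0 -> beta x s <> c *: (s + 1).
  move=> gens sm c0 xs; move: pd; rewrite dimE => /eqP; apply.
  exact: dim_eq0_of_shifted prim _ _ _ gens sm c0 xs.
split=> [beta||beta].
- by have := no_shift beta t m 1 gen tm (oner_neq0 _); rewrite scale1r.
- exact: not01.
have [[s [ms [g [gens sm hs]]]]|[s [ms [g [gens sm g_neq1 hs]]]]] := classify beta.
  exact: linear_case gens sm hs.
case: (no_shift beta s ms (x g) gens sm); first exact: primitive_neq0.
exact: act_primitive_shift.
Qed.
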